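(* Let $n \ge 1$. There is a partition of the set $\binom{[2n]}{n}$ of $n$-subsets of $[2n]$ into sets $\mathcal{Q}_v$ indexed by the $123$-avoiding permutations $v \in S_n$ such that: (1) for any $w \in S_n$, $\mathcal{P}_w$ is the disjoint union $$\mathcal{P}_w = \bigsqcup_{\substack{v \in S_n,\ v \geq w \\ v \text{ avoids } 123}} \mathcal{Q}_v,$$ where $\geq$ is the strong Bruhat order on $S_n$; (2) if $v$ has maximal runs of consecutive anti-fixed points of lengths $\ell_1, \ldots, \ell_k$, then $\mathcal{Q}_v$ is the set of bases of a matroid on $[2n]$ which is isomorphic to a direct sum of the reduced Catalan matroids $\mathcal{C}'_{\ell_1+1}, \ldots, \mathcal{C}'_{\ell_k+1}$ and a matroid with exactly one basis. In particular, $\#\mathcal{Q}_v = g(v)$.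
   Context: For integers $a \le b$, $[a,b] = \{a, a+1, \ldots, b\}$ and $[n]=[1,n]$. For $w \in S_n$, let $M_w$ be a generic $n \times 2n$ matrix whose nonzero entries in row $i$ are exactly in columns $[w(i), i+n]$ (generic: the nonzero entries are algebraically independent). $\mathcal{P}_w$ is the set of $n$-subsets $I$ of $[2n]$ such that the $n \times n$ minor of $M_w$ in rows $[n]$ and columns $I$ is nonzero. Equivalently, $\mathcal{P}_w$ is the set of transversals of the set collection $([w(i), i+n])_{1 \le i \le n}$. An anti-fixed point of $v \in S_n$ is $i \in [n]$ with $v(i) = n-i+1$. If $\ell_1, \ldots, \ell_k$ are the lengths of the maximal runs of consecutive anti-fixed points of $v$, then $g(v) = C_{\ell_1+1} \cdots C_{\ell_k+1}$, where $C_j = \frac{1}{j+1}\binom{2j}{j}$ (an empty product is $1$). A permutation avoids $123$ if it has no (not necessarily consecutive) increasing subsequence of length $3$. A Dyck path of length $2m$ is a lattice path from $(0,0)$ to $(2m,0)$ with steps $(1,1)$ (upsteps) and $(1,-1)$ (downsteps) never going below $y=0$. The Catalan matroid $\mathcal{C}_m$ is the matroid on $[2m]$ whose bases are the sets $\{i \in [2m] : \text{step } i \text{ of } D \text{ is an upstep}\}$ for $D$ a Dyck path of length $2m$. For $m \ge 1$, the element $1$ is a coloop of $\mathcal{C}_m$ and the element $2m$ is a loop; the reduced Catalan matroid $\mathcal{C}'_m$ is the matroid on $[2, 2m-1]$ obtained by removing them, i.e. its bases are the sets $B \setminus \{1\}$ for $B$ a basis of $\mathcal{C}_m$. *)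

(* Defs.v *)
From HB Require Import structures.
From mathcomp Require Import all_boot all_order all_algebra all_fingroup.
From mathcomp Require Import mpoly.

Set Implicit Arguments.
Unset Strict Implicit.
Unset Printing Implicit Defensive.

Import GRing.Theory.
Local Open Scope ring_scope.

(* Everything is 0-based: 'I_n and 'I_(2 * n) stand for [n] and [2n], shifted
   by one; 'S_n is the symmetric group on 'I_n. *)

Definition inversions (n : nat) (w : 'S_n) : {set 'I_n * 'I_n} :=
  [set p : 'I_n * 'I_n | (p.1 < p.2)%N && (w p.2 < w p.1)%N].

Definition bruhat_step (n : nat) (u v : 'S_n) : bool :=
  [exists a : 'I_n, exists b : 'I_n,
    [&& a != b, v == (tperm a b * u)%g & (#|inversions u| < #|inversions v|)%N]].

(* The strong Bruhat order is the reflexive transitive closure of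
   u -> u t, for t a transposition such that u t is longer than u. *)
Definition bruhat_le (n : nat) (u v : 'S_n) : bool :=
  connect (@bruhat_step n) u v.

Definition avoids123 (n : nat) (v : 'S_n) : bool :=
  ~~ [exists i : 'I_n, exists j : 'I_n, exists k : 'I_n,
      [&& (i < j)%N, (j < k)%N, (v i < v j)%N & (v j < v k)%N]].

Definition antifixed (n : nat) (v : 'S_n) (i : 'I_n) : bool :=
  v i == rev_ord i.

Definition antifixed_run (n : nat) (v : 'S_n) (r : 'I_n * 'I_n) : bool :=
  (r.1 <= r.2)%N &&
  [forall i : 'I_n, (r.1 <= i <= r.2)%N ==> antifixed v i].

(* A maximal run a, a+1, ..., b is encoded by its pair of endpoints (a, b). *)
Definition max_antifixed_runs (n : nat) (v : 'S_n) : {set 'I_n * 'I_n} :=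
  [set r : 'I_n * 'I_n | antifixed_run v r &&
    [forall s : 'I_n * 'I_n,
      [&& antifixed_run v s, (s.1 <= r.1)%N & (r.2 <= s.2)%N] ==> (s == r)]].

Definition run_length (n : nat) (r : 'I_n * 'I_n) : nat := (r.2 - r.1).+1.

Definition catalan_number (j : nat) : nat := ('C(2 * j, j) %/ j.+1)%N.

Definition g (n : nat) (v : 'S_n) : nat :=
  (\prod_(r in max_antifixed_runs v) catalan_number (run_length r).+1)%N.

(* The nonzero entries are distinct indeterminates over F. With 0-based rows
   and columns the support of row i is still [w(i), i + n]. *)
Definition generic_mx (F : fieldType) (n : nat) (w : 'S_n) :
    'M[{mpoly F[n * (2 * n)]}]_(n, 2 * n) :=
  \matrix_(i < n, j < 2 * n)
    if (w i <= j <= i + n)%N then 'X_(mxvec_index i j) else 0.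

Lemma leq_double_dim (n : nat) : (n <= 2 * n)%N.
Proof. exact: leq_pmull. Qed.

(* The k-th smallest element of I; the default value of nth is irrelevant
   when #|I| = n. *)
Definition sorted_col (n : nat) (I : {set 'I_(2 * n)}) (k : 'I_n) :
    'I_(2 * n) :=
  nth (widen_ord (leq_double_dim n) k) (enum I) k.

Definition P (F : fieldType) (n : nat) (w : 'S_n) : {set {set 'I_(2 * n)}} :=
  [set I : {set 'I_(2 * n)} |
    (#|I| == n) && (\det (colsub (sorted_col I) (generic_mx F w)) != 0)].

(* Matroids, given by their families of bases; the ground set is the whole
   finite type. *)

Definition is_matroid (T : finType) (M : {set {set T}}) : Prop :=
  M != set0 /\
  forall A B : {set T}, A \in M -> B \in M ->
  forall a : T, a \in A :\: B ->
  exists2 b : T, b \in B :\: A & b |: (A :\ a) \in M.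

Definition matroid_iso (T1 T2 : finType)
    (M1 : {set {set T1}}) (M2 : {set {set T2}}) : Prop :=
  exists2 f : T1 -> T2, bijective f & M2 = [set f @: B | B : {set T1} in M1].

Definition direct_sum2 (T1 T2 : finType)
    (M1 : {set {set T1}}) (M2 : {set {set T2}}) :
    {set {set (T1 + T2)%type}} :=
  [set B : {set (T1 + T2)%type} |
    ([set x | inl x \in B] \in M1) && ([set y | inr y \in B] \in M2)].

Definition direct_sum (I : finType) (T : I -> finType)
    (M : forall i : I, {set {set T i}}) : {set {set {i : I & T i}}} :=
  [set B : {set {i : I & T i}} |
    [forall i : I, [set x : T i | Tagged T x \in B] \in M i]].

(* A path is its sequence of steps, true being an upstep. *)
Definition height (s : seq bool) : int :=
  \sum_(b <- s) (if b then 1 else - 1).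

Definition is_dyck (s : seq bool) : bool :=
  [forall k : 'I_(size s).+1, 0 <= height (take k s)] && (height s == 0).

Definition catalan_matroid (m : nat) : {set {set 'I_(2 * m)}} :=
  [set [set i : 'I_(2 * m) | tnth D i]
    | D : (2 * m).-tuple bool in [pred D : (2 * m).-tuple bool | is_dyck D]].

(* [2, 2m-1], shifted by one. *)
Definition reduced_ground (m : nat) : finType :=
  {x : 'I_(2 * m) | (0 < x < (2 * m).-1)%N}.

(* As no basis of the Catalan matroid contains the last element, restricting
   a basis to reduced_ground removes exactly its first element. *)
Definition reduced_catalan_matroid (m : nat) :
    {set {set reduced_ground m}} :=
  [set [set x : reduced_ground m | val x \in B]
    | B : {set 'I_(2 * m)} in catalan_matroid m].

Definition run_catalan_sum (n : nat) (v : 'S_n) :=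
  direct_sum (fun r : {r : 'I_n * 'I_n | r \in max_antifixed_runs v} =>
    reduced_catalan_matroid (run_length (val r)).+1).

Definition is_disjoint_union (I T : finType) (D : {set I})
    (Q : I -> {set T}) (A : {set T}) : Prop :=
  {in D &, forall u v : I, u != v -> [disjoint Q u & Q v]} /\
  A = \bigcup_(v in D) Q v.

(* Main.v *)
Require Import Defs.
From HB Require Import structures.
From mathcomp Require Import all_boot all_order all_algebra all_fingroup.
From mathcomp Require Import mpoly.
From mathcomp Require Import zify.

(* Reverse the values of v, so that "123" becomes "321" and antifixed points
   become fixed points of a permutation u. Encode an n-set I of columns by the
   indicators c_i of n + i and a_i of n - 1 - i (0-based), with prefix sums C and
   A. An interval transversal of I for w bounds the northwest rank function of w by
   min(p, q, C p + A q). This bound is itself the rank function of a permutation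
   u(I), which avoids 321, so by the tableau criterion w is below u(I). Conversely
   I is an interval transversal for u(I), and this property is inherited by smaller
   permutations. The blocks are the fibres of I |-> u(I).
   The index i is a fixed point of u(I) exactly when the walk p - C p - A p is
   nonpositive at i and i + 1; at the other indices u determines c_i and a_i. So
   the only freedom in the fibre of u is, over each maximal run of fixed points, a
   nonpositive excursion of this walk, i.e. a Dyck path with its first and last
   step removed. *)

Set Implicit Arguments.
Unset Strict Implicit.
Unset Printing Implicit Defensive.
Import GRing.Theory.

(** * Prefix counts and rank functions *)

Section PrefixCount.
Variable n : nat.
Implicit Types (A B : pred 'I_n) (p q : nat).

(** The map from I to u(I) is never defined as a function. It is replaced by a relation
    [compatible u c a] between a permutation and the two halves of I. For u avoiding 321 this
    relation forces the rank function min(p, q, C p + A q) ([compatible_rank]), so I lies in at most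
    one block; [compatible_exists] produces such a u, so I lies in at least one. The relation is
    chosen because it splits: at non-fixed indices it prescribes c and a, and at fixed points it
    only compares two counts, which must agree at the ends of every run. After relabelling the
    columns, this is membership in a direct sum with one summand per run and one summand with a
    single basis ([compatible_direct_sum]). A block can therefore be defined by the direct sum,
    while (1) is proved from the relation. *)

Definition prefix_count A p := #|[set i : 'I_n | (i < p) && A i]|.

Lemma prefix_count0 A : prefix_count A 0 = 0.
Proof. by apply: eq_card0 => i; rewrite !inE. Qed.

Lemma eq_prefix_count A B p :
  (forall i : 'I_n, i < p -> A i = B i) -> prefix_count A p = prefix_count B p.
Proof.
by move=> eqAB; apply: eq_card => i; rewrite !inE; case: ltnP => //= /eqAB->.
Qed.

Lemma prefix_count_sub A B p :
  (forall i : 'I_n, i < p -> A i -> B i) -> prefix_count A p <= prefix_count B p.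
Proof.
move=> sAB; apply/subset_leq_card/subsetP => i.
by rewrite !inE => /andP[lt_ip /(sAB _ lt_ip)->]; rewrite lt_ip.
Qed.

Lemma prefix_countS A (i : 'I_n) :
  prefix_count A i.+1 = prefix_count A i + A i.
Proof.
rewrite /prefix_count (cardsD1 i) inE leqnn /= addnC; congr (_ + _).
by apply: eq_card => j; rewrite !inE ltnS leq_eqVlt -val_eqE /=; case: ltngtP.
Qed.

Lemma prefix_count_split A B p :
  prefix_count A p =
  prefix_count (predI A B) p + prefix_count (predI A (predC B)) p.
Proof.
rewrite /prefix_count -(cardsID [set i | B i]); congr (_ + _).
  by apply: eq_card => i; rewrite !inE -andbA.
by apply: eq_card => i; rewrite !inE /= andbC -andbA.
Qed.

Lemma prefix_countT p : p <= n -> prefix_count predT p = p.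
Proof.
elim: p => [|p IHp] lt_pn; first by rewrite prefix_count0.
by rewrite (prefix_countS predT (Ordinal lt_pn)) /= IHp ?addn1 // ltnW.
Qed.

Lemma prefix_count_full A p : n <= p -> prefix_count A p = #|[set i | A i]|.
Proof.
by move=> le_np; apply: eq_card => i; rewrite !inE (leq_trans (ltn_ord i)).
Qed.

Lemma prefix_count_diff A p q : p <= q <= n ->
  prefix_count A p <= prefix_count A q <= prefix_count A p + (q - p).
Proof.
case/andP; elim: q => [|q IHq] le_pq lt_qn.
  by move: le_pq; rewrite leqn0 => /eqP->; lia.
have := prefix_countS A (Ordinal lt_qn) => /= ->.
move: le_pq; rewrite leq_eqVlt => /orP[/eqP-> | lt_pq].
  by have := prefix_countS A (Ordinal lt_qn) => /= ->; lia.
by have := IHq lt_pq (ltnW lt_qn); case: (A _) => /=; lia.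
Qed.

End PrefixCount.

Section PermRank.
Variable n : nat.
Implicit Types u v : 'S_n.

Definition perm_rank u p q := prefix_count (fun i => u i < q) p.

Lemma perm_rankV u p q : perm_rank u^-1 q p = perm_rank u p q.
Proof.
rewrite /perm_rank /prefix_count -[RHS](card_imset _ (@perm_inj _ u)).
apply: eq_card => i; rewrite !inE; apply/idP/imsetP.
  by case/andP=> ? ?; exists (u^-1%g i); rewrite ?inE permKV //; apply/andP.
by case=> j; rewrite inE andbC => + ->; rewrite permK.
Qed.

Lemma perm_rankSl u (i : 'I_n) q :
  perm_rank u i.+1 q = perm_rank u i q + (u i < q).
Proof. exact: prefix_countS. Qed.

Lemma perm_rankSr u p (j : 'I_n) :
  perm_rank u p j.+1 = perm_rank u p j + (u^-1%g j < p).
Proof. by rewrite -!(perm_rankV u) perm_rankSl. Qed.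

(** At [q = u i + 1] row [i] contributes to the rank of [u], hence to that of [v], which gives
    [v i <= u i]; the other inequality is symmetric. *)
Lemma perm_rank_inj u v :
  (forall p q, p <= n -> q <= n -> perm_rank u p q = perm_rank v p q) -> u = v.
Proof.
move=> eq_uv; apply/permP => i; apply/val_inj.
have lt_in := ltn_ord i; have lt_uin := ltn_ord (u i).
have lt_vin := ltn_ord (v i).
have := perm_rankSl u i (u i).+1; have := perm_rankSl v i (u i).+1.
have := perm_rankSl u i (v i).+1; have := perm_rankSl v i (v i).+1.
rewrite !eq_uv ?ltnSn //; try lia.
by move=> /= + + + +; lia.
Qed.

End PermRank.

(** * Permutations avoiding 321 *)

Section Permutation321.
Variables (n : nat) (u : 'S_n).

Definition avoids321 := forall i j k : 'I_n,
  i < j -> j < k -> u j < u i -> u k < u j -> False.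

Lemma avoids321_deficiency (i j : 'I_n) :
  avoids321 -> i < j -> u j < u i -> u j < j.
Proof.
move=> u321 lt_ij lt_u.
(* Every value below [u j] occurs before [j], at a position other than [i]. *)
have <- : perm_rank u j (u j) = u j.
  have le_ujn : u j <= n by exact: ltnW.
  rewrite -[RHS](prefix_countT le_ujn) -(perm_rankV u) /perm_rank.
  apply: eq_prefix_count => k lt_ku; case: ltngtP => // [lt_jk|eq_jk].
    by case: (u321 i j (u^-1%g k)) => //; rewrite permKV.
  have ejk : j = (u^-1%g k) by apply: val_inj; rewrite /= eq_jk.
  by move: lt_ku; rewrite ejk permKV ltnn.
have le_jn : j <= n by exact: ltnW.
rewrite -[X in _ < X](prefix_countT le_jn).
rewrite [X in _ < X](prefix_count_split _ (fun k => u k < u j)).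
rewrite -addn1 leq_add // card_gt0; apply/set0Pn; exists i.
by rewrite !inE lt_ij /= -leqNgt ltnW.
Qed.

End Permutation321.

Lemma avoids321V n (u : 'S_n) : avoids321 u -> avoids321 u^-1.
Proof.
move=> u321 i j k lt_ij lt_jk lt1 lt2.
by apply: (u321 (u^-1%g k) (u^-1%g j) (u^-1%g i)); rewrite ?permKV.
Qed.

(** * Tableau criterion for the Bruhat order *)

Section Bruhat.
Variable n : nat.
Implicit Types u v w : 'S_n.

(** An inversion is carried to the exchanged positions when these are still in increasing order, and
    is kept otherwise. This is an injection into the inversions of the new permutation, and it
    misses [(a, b)]. *)
Lemma inversions_tperm u (a b : 'I_n) : a < b -> u a < u b ->
  #|inversions u| < #|inversions (tperm a b * u)%g|.
Proof.
move=> lt_ab lt_u; set t := tperm a b.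
pose f (p : 'I_n * 'I_n) := if t p.1 < t p.2 then (t p.1, t p.2) else p.
have f_inj : {in inversions u &, injective f}.
  move=> [i j] [i' j']; rewrite !inE /f /= => /andP[lt_ij _] /andP[lt_ij' _].
  case: ltnP => lt_t; case: ltnP => lt_t' // [].
  - by move=> /perm_inj-> /perm_inj->.
  - by move=> ei ej; move: lt_t'; rewrite -ei -ej !tpermK leqNgt lt_ij.
  - by move=> ei ej; move: lt_t; rewrite ei ej !tpermK leqNgt lt_ij'.
rewrite -(card_in_imset f_inj); apply/proper_card/properP; split; last first.
  exists (a, b); first by rewrite !inE /= !permM tpermL tpermR lt_ab.
  apply/imsetP => -[[i j]]; rewrite !inE /f /= => /andP[lt_ij lt_uij].
  case: ltnP => _ [ea eb].
    have := lt_ij; rewrite -(tpermK a b i) -(tpermK a b j) -/t -ea -eb.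
    by rewrite tpermL tpermR ltnNge ltnW.
  by move: lt_uij; rewrite -ea -eb ltnNge ltnW.
apply/subsetP => _ /imsetP[[i j] + ->]; rewrite !inE /f /=.
case/andP=> lt_ij lt_uij; case: (ltnP (t i) (t j)) => [lt_t|ge_t]; rewrite /= !permM.
  by rewrite !tpermK lt_t.
move: ge_t; rewrite lt_ij /= /t; case: tpermP => [ei|ei|/eqP ni1 /eqP ni2];
  case: tpermP => [ej|ej|/eqP nj1 /eqP nj2] //; subst; lia.
Qed.

(** If [u b < u a] held for positions [a < b], undoing the exchange would add inversions too, a
    contradiction. *)
Lemma bruhat_stepP u v : bruhat_step u v ->
  exists a b : 'I_n, [/\ a < b, u a < u b & v = (tperm a b * u)%g].
Proof.
have step (a b : 'I_n) : a < b -> #|inversions u| < #|inversions (tperm a b * u)%g| ->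
    u a < u b.
  move=> lt_ab lt_inv; case: ltngtP => // [lt_u|/val_inj/perm_inj eab].
    have := @inversions_tperm (tperm a b * u)%g a b lt_ab.
    rewrite mulgA tperm2 mul1g !permM tpermL tpermR => /(_ lt_u).
    by rewrite ltnNge ltnW.
  by rewrite eab ltnn in lt_ab.
case/existsP=> a /existsP[b] /and3P[ne_ab /eqP-> lt_inv].
case: (ltngtP a b) => [lt_ab|lt_ab|/val_inj eab]; last by rewrite eab eqxx in ne_ab.
  by exists a, b; split=> //; apply: step.
by exists b, a; rewrite tpermC; split=> //; apply: step; rewrite // tpermC.
Qed.

(** The count of the tableau criterion; [corner_flip] identifies it with the rank function of the
    reversed permutation. *)
Definition corner u p q := prefix_count (fun i => q <= u i) p.

Lemma corner_split u p q r : q <= r ->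
  corner u p q = corner u p r + prefix_count (fun i => q <= u i < r) p.
Proof.
move=> le_qr; rewrite /corner (prefix_count_split _ (fun i => r <= u i)).
by congr (_ + _); apply: eq_prefix_count => i _ /=; lia.
Qed.

Lemma corner_tperm u (a b : 'I_n) p q : a < b -> u a < u b ->
  corner (tperm a b * u)%g p q
  = corner u p q + ((a < p <= b) && (u a < q <= u b)).
Proof.
move=> lt_ab lt_u; rewrite /corner /prefix_count.
rewrite (cardsD1 a) [in RHS](cardsD1 a) (cardsD1 b) [in RHS](cardsD1 b) !inE.
rewrite !permM tpermL tpermR.
rewrite (_ : #|_ :\ a :\ b| = #|[set i : 'I_n | (i < p) && (q <= u i)] :\ a :\ b|).
  have -> : (b == a) = false by apply/eqP=> eab; rewrite eab ltnn in lt_ab.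
  by rewrite /=; lia.
apply: eq_card => i; rewrite !inE permM.
by case: tpermP => [->|->|]; rewrite ?eqxx ?andbF.
Qed.

(* At the first row [a] where [u] and [v] differ, exchange [u a] with the next entry
   of [u] in the interval from [u a] to [v a]: the corner counts stay below those of
   [v]. *)
Lemma corner_le_bruhat u v :
  (forall p q, corner u p q <= corner v p q) -> bruhat_le u v.
Proof.
have [k] := ubnP (#|{: 'I_n * 'I_n}| - #|inversions u|).
elim: k u => // k IHk u lt_k le_uv; have [->|ne_uv] := eqVneq u v.
  exact: connect0.
have [i0 ne_i0] : exists i, u i != v i.
  apply/existsP; apply: contraNT ne_uv => /existsPn eq_uv.
  by apply/eqP/permP => i; apply/eqP; move: (eq_uv i); rewrite negbK.
case: (@arg_minnP _ i0 (fun i => u i != v i) val ne_i0) => a ne_a min_a.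
have eq_a (i : 'I_n) : i < a -> u i = v i.
  by move=> lt_ia; apply/eqP; apply: contraTT lt_ia => /min_a; rewrite -leqNgt.
have cornerS w (i : 'I_n) q : corner w i.+1 q = corner w i q + (q <= w i).
  exact: prefix_countS.
have eq_corner q : corner u a q = corner v a q.
  by apply: eq_prefix_count => i /eq_a->.
have lt_a : u a < v a.
  have := le_uv a.+1 (u a); rewrite !cornerS eq_corner leqnn leq_add2l.
  by move: ne_a; rewrite -val_eqE /=; lia.
have [b0 /andP[lt_b0 /andP[lt_ub0 le_ub0]]] :
    exists b : 'I_n, (a < b) && (u a < u b <= v a).
  exists (u^-1%g (v a)); rewrite permKV lt_a leqnn !andbT.
  case: ltngtP => //.
    by move=> /[dup] /eq_a; rewrite permKV => /perm_inj<-; rewrite ltnn.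
  by move=> /val_inj ea; move: lt_a; rewrite {1}ea permKV ltnn.
have b0P : (a < b0) && (u a < u b0 <= v a) by rewrite lt_b0 lt_ub0.
case: (@arg_minnP _ b0 (fun b => (a < b) && (u a < u b <= v a)) val b0P) => b.
case/andP=> lt_ab /andP[lt_ub le_ub] min_b.
have gap (i : 'I_n) : a < i < b -> ~~ (u a < u i <= v a).
  case/andP=> lt_ai lt_ib; apply: contraTN lt_ib => Hi.
  by rewrite -leqNgt; apply: min_b; rewrite lt_ai.
pose u' := (tperm a b * u)%g.
have lt_inv : #|inversions u| < #|inversions u'| by apply: inversions_tperm.
have max_inv w : #|inversions w| <= #|{: 'I_n * 'I_n}| by apply: max_card.
apply: (@connect_trans _ _ u').
  apply: connect1; apply/existsP; exists a; apply/existsP; exists b.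
  by rewrite eqxx lt_inv !andbT; apply/eqP=> eab; rewrite eab ltnn in lt_ab.
apply: IHk => [|p q]; first by have := max_inv u'; have := max_inv u; lia.
rewrite corner_tperm //; case: andP => [[/andP[lt_ap le_pb] /andP[lt_q le_q]]|_].
  (* Values above [v a] are controlled by the hypothesis at level [v a + 1]. By [gap], the rows of
     [u] before [p] with value between [q] and [v a] all precede [a], where [u] and [v] agree. There
     [v] has one more such row, namely [a], which absorbs the added 1. *)
  rewrite (@corner_split u p q (v a).+1) ?(@corner_split v p q (v a).+1); try lia.
  rewrite -addnA leq_add //.
  have -> : prefix_count (fun i => q <= u i < (v a).+1) p
          = prefix_count (fun i => q <= u i < (v a).+1) a.
    apply: eq_card => i; rewrite !inE; case: (ltngtP i a) => //=.
    - by move=> lt_ia; rewrite (ltn_trans lt_ia).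
    - move=> lt_ai; have := gap i; rewrite lt_ai /=.
      by case: (ltnP i p) => //= lt_ip; move/(_ (leq_trans lt_ip le_pb)); lia.
    - by move=> /val_inj->; lia.
  apply: (@leq_trans (prefix_count (fun i => q <= v i < (v a).+1) a.+1)).
    rewrite prefix_countS ltnSn leq_add //; last by lia.
    by apply: prefix_count_sub => i /eq_a->.
  apply/subset_leq_card/subsetP => i; rewrite !inE => /andP[lt_i ->].
  by rewrite (leq_trans lt_i).
by rewrite addn0.
Qed.

End Bruhat.

(** * Generic minors and transversals *)

Section Transversals.
Variable n : nat.
Implicit Types (v w : 'S_n) (I : {set 'I_(2 * n)}).

Definition interval_transversal w I (f : 'I_n -> 'I_(2 * n)) :=
  [/\ injective f, forall i, f i \in I & forall i : 'I_n, w i <= f i <= i + n].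

Lemma sorted_col_mem I k : #|I| = n -> sorted_col I k \in I.
Proof. by move=> cardI; rewrite -mem_enum mem_nth // -cardE cardI. Qed.

Lemma sorted_col_inj I : #|I| = n -> injective (sorted_col I).
Proof.
move=> cardI k l /eqP; rewrite /sorted_col.
rewrite (set_nth_default (widen_ord (leq_double_dim n) l)) -?cardE ?cardI //.
by rewrite nth_uniq ?enum_uniq -?cardE ?cardI // => /eqP/val_inj.
Qed.

Lemma sorted_col_onto I x : #|I| = n -> x \in I -> exists k, x = sorted_col I k.
Proof.
move=> cardI xI.
have lt_xn : index x (enum I) < n by move: xI; rewrite -mem_enum -index_mem -cardE cardI.
by exists (Ordinal lt_xn); rewrite /sorted_col nth_index ?mem_enum.
Qed.

Lemma mem_P_transversal (F : fieldType) w I :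
  I \in P F w <-> #|I| = n /\ exists f, interval_transversal w I f.
Proof.
rewrite inE; split=> [/andP[/eqP cardI det_neq0]|[cardI [f [f_inj fI f_w]]]].
  split=> //; have [s s_neq0] : exists s : 'S_n, forall i : 'I_n,
      colsub (sorted_col I) (generic_mx F w) i (s i) != 0%R.
    suff /existsP[s /forallP] : [exists s : 'S_n, [forall i,
        colsub (sorted_col I) (generic_mx F w) i (s i) != 0%R]] by exists s.
    apply: contraNT det_neq0 => /existsPn det_eq0.
    apply/eqP; rewrite /determinant big1 // => s _.
    move/(_ s): det_eq0; rewrite negb_forall => /existsP[i].
    by rewrite negbK => /eqP s_eq0; rewrite (bigD1 i) //= s_eq0 mul0r mulr0.
  exists (fun i => sorted_col I (s i)); split=> [i j|i|i].
  - by move/(sorted_col_inj cardI)/perm_inj.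
  - exact: sorted_col_mem.
  - by have := s_neq0 i; rewrite !mxE; case: ifP => //; rewrite eqxx.
have [s sE] : exists s : 'I_n -> 'I_n, forall i, f i = sorted_col I (s i).
  apply: (@fin_all_exists _ (fun=> 'I_n) (fun i k => f i = sorted_col I k)) => i.
  exact: sorted_col_onto.
have s_inj : injective s by move=> i j eq_s; apply: f_inj; rewrite !sE eq_s.
(* Specialising the indeterminate at (i, f i) to 1 and all others to 0 turns
   the minor into the determinant of a permutation matrix. *)
pose spec := mxvec (\matrix_(i < n, j < 2 * n) ((j == f i)%:R : F))%R ord0.
have det_spec : (meval spec (\det (colsub (sorted_col I) (generic_mx F w)))
    = (-1) ^+ perm s_inj)%R.
  rewrite -det_perm -det_map_mx; congr (\det _)%R; apply/matrixP => i k.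
  rewrite !mxE permE; case: ifP => [_|].
    by rewrite /= mevalXU /spec mxvecE mxE sE (inj_eq (sorted_col_inj cardI)) eq_sym.
  by case: eqP => [<-|_ _]; rewrite -?sE ?f_w //= meval0.
rewrite cardI eqxx; apply: contra_eqN det_spec => /eqP->.
by rewrite meval0 eq_sym signr_eq0.
Qed.

(** In the hypothesis row [a] has the interval from [w b] and row [b] the one from [w a]. If
    [w b <= f b], then [f] already works for [w]. Otherwise [f b < w b < n] fits row [a], and the
    two rows trade columns. *)
Lemma transversal_tperm w I (a b : 'I_n) : a < b -> w a < w b ->
  (exists f, interval_transversal (tperm a b * w)%g I f) ->
  exists f, interval_transversal w I f.
Proof.
move=> lt_ab lt_w [f [f_inj fI f_w]].
have fa := f_w a; have fb := f_w b; have lt_an := ltn_ord a.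
have lt_wb := ltn_ord (w b).
rewrite !permM tpermL in fa; rewrite !permM tpermR in fb.
have [le_wf|lt_fw] := leqP (w b) (f b).
  exists f; split=> // i; have := f_w i; rewrite permM.
  by case: tpermP => [->|->|] // _; lia.
exists (fun i => f (tperm a b i)); split=> // [i j|i].
  by move/f_inj/perm_inj.
case: tpermP => [->|->|/eqP ia /eqP ib]; [lia..|].
by have := f_w i; rewrite permM tpermD // eq_sym.
Qed.

Lemma transversal_bruhat v w I : bruhat_le w v ->
  (exists f, interval_transversal v I f) -> exists f, interval_transversal w I f.
Proof.
case/connectP=> p; elim: p w => [|x p IHp] w /=; first by move=> _ ->.
case/andP=> /bruhat_stepP[a [b [lt_ab lt_w xE]]] path_p vE fv.
by apply: (transversal_tperm lt_ab lt_w); rewrite -xE; apply: IHp.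
Qed.

End Transversals.

(** * The permutation attached to a set of columns *)

Lemma perm_of_rank n (h : nat -> nat -> nat) :
    (forall q, q <= n -> h 0 q = 0) -> (forall p, p <= n -> h p 0 = 0) ->
    (forall q, q <= n -> h n q = q) -> (forall p, p <= n -> h p n = p) ->
    (forall p q, p < n -> q < n ->
      h p.+1 q + h p q.+1 <= h p q + h p.+1 q.+1) ->
  exists u : 'S_n, forall p q, p <= n -> q <= n -> perm_rank u p q = h p q.
Proof.
move=> h0q hp0 hnq hpn h_super.
have mono (i : 'I_n) q q' : q <= q' <= n -> h i.+1 q + h i q' <= h i q + h i.+1 q'.
  case/andP; elim: q' => [|q' IHq]; first by rewrite leqn0 => /eqP->; lia.
  rewrite leq_eqVlt => /orP[/eqP->|]; first by lia.
  by rewrite ltnS => /IHq{}IHq lt_qn; have := h_super i q' (ltn_ord i) lt_qn; lia.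
(* The increment [q |-> h (i + 1) q - h i q] climbs from 0 to 1; the value of the
   permutation at [i] is the place where it jumps. *)
have jump (i : 'I_n) : exists k : 'I_n, forall q, q <= n ->
    h i.+1 q = h i q + (k < q).
  have hi := hpn i (ltnW (ltn_ord i)); have hi1 := hpn i.+1 (ltn_ord i).
  have h0 := hp0 i (ltnW (ltn_ord i)); have h01 := hp0 i.+1 (ltn_ord i).
  have ex_q : exists q, h i q < h i.+1 q by exists n; rewrite hi hi1.
  case: (ex_minnP ex_q) => q0 lt_q0 min_q0.
  have le_q0n : q0 <= n by apply: min_q0; rewrite hi hi1.
  have q0_gt0 : 0 < q0 by case: q0 lt_q0 {min_q0 le_q0n} => //; rewrite h0 h01.
  have lt_qn : q0.-1 < n by lia.
  exists (Ordinal lt_qn) => q le_qn /=.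
  have m1 := mono i 0 q; have m2 := mono i q n.
  have := min_q0 q; have m3 := mono i q0 q; lia.
have [f fE] := fin_all_exists jump.
have rank_f p q : p <= n -> q <= n -> prefix_count (fun i => f i < q) p = h p q.
  elim: p => [|p IHp] lt_pn le_qn; first by rewrite prefix_count0 h0q.
  have /= -> := prefix_countS (fun i => f i < q) (Ordinal lt_pn).
  by have /= -> := fE (Ordinal lt_pn) _ le_qn; rewrite IHp // ltnW.
(* Exactly [q] rows take a value below [q], so two rows with the same value would make this number
   jump by at least 2. *)
have f_inj : injective f.
  have card_f q : q <= n -> #|[set i | f i < q]| = q.
    by move=> le_qn; rewrite -[RHS]hnq // -rank_f // prefix_count_full.
  move=> i j eq_f; have lt_fn := ltn_ord (f i).
  have [//|ne_ij] := eqVneq i j; have := card_f _ lt_fn.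
  rewrite (cardsD1 i) (cardsD1 j (_ :\ i)) !inE eq_sym ne_ij -eq_f ltnSn.
  suff : f i <= #|[set k | f k < (f i).+1] :\ i :\ j| by lia.
  rewrite -[X in X <= _](card_f _ (ltnW lt_fn)).
  apply/subset_leq_card/subsetP => k; rewrite !inE => lt_fk.
  rewrite ltnS (ltnW lt_fk) andbT; apply/andP; split.
    by apply: contraTneq lt_fk => ->; rewrite -eq_f ltnn.
  by apply: contraTneq lt_fk => ->; rewrite ltnn.
exists (perm f_inj) => p q le_pn le_qn; rewrite -rank_f //.
by apply: eq_prefix_count => i _; rewrite permE.
Qed.

(** * Permutations compatible with the two halves of a set *)

Section Compatible.
Variable n : nat.
Implicit Types (u : 'S_n) (c a : pred 'I_n).

(** Both sides of every non-fixed index, and the right end: the places where an excursion must be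
    back at 0. At position 0 all counts vanish anyway. *)
Definition run_boundary u p :=
  p = n \/ exists i : 'I_n, u i != i /\ (i = p :> nat \/ i.+1 = p).

Definition fixed_count u p := prefix_count (fun i => u i == i) p.

(** [fixed_count - fixed_weight] is the walk with its steps at non-fixed indices deleted. *)
Definition fixed_weight u c a p :=
  prefix_count (predI (fun i => u i == i) c) p
  + prefix_count (predI (fun i => u i == i) a) p.

(* [c] and [a] are the indicator functions of the upper and of the (reversed)
   lower half of a subset of the columns. *)
Definition compatible u c a :=
  [/\ forall i, u i != i -> c i = (u i < i),
      forall i, u i != i -> a i = ((u^-1)%g i < i)
    & forall p, p <= n -> fixed_count u p <= fixed_weight u c a p /\
        (run_boundary u p -> fixed_count u p = fixed_weight u c a p)].

Lemma permV_fixed u i : ((u^-1)%g i == i) = (u i == i).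
Proof. by rewrite -(inj_eq (@perm_inj _ u)) permKV eq_sym. Qed.

(** Inversion exchanges the two halves; this reduces [compatible_rank] to the case [p <= q]. *)
Lemma compatibleV u c a : compatible u c a -> compatible u^-1 a c.
Proof.
case=> uc ua ufix; split=> [i|i|p le_pn]; rewrite ?permV_fixed.
- exact: ua.
- by rewrite invgK; apply: uc.
have fixE A : prefix_count (predI (fun i => (u^-1)%g i == i) A) p
            = prefix_count (predI (fun i => u i == i) A) p.
  by apply: eq_prefix_count => i _ /=; rewrite permV_fixed.
rewrite /fixed_count /fixed_weight !fixE addnC.
rewrite (@eq_prefix_count _ _ (fun i => u i == i)) => [|i _]; last first.
  exact: permV_fixed.
have [le_p eq_p] := ufix p le_pn; split=> // -[pn|[i []]]; first by apply: eq_p; left.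
by rewrite permV_fixed => ui ip; apply: eq_p; right; exists i.
Qed.

(** The deficiencies of [u^-1] counted here are the values [u i] of the exceedances [i < u i]. *)
Lemma compatible_exceedances u c a p q :
    compatible u c a ->
    prefix_count c p + prefix_count a q
    = prefix_count (fun i => u i < i) p + prefix_count (fun i => (u^-1)%g i < i) q
      + (prefix_count (predI (fun i => u i == i) c) p
         + prefix_count (predI (fun i => u i == i) a) q).
Proof.
case=> uc ua _; rewrite [prefix_count c p](prefix_count_split _ (fun i => u i == i)).
rewrite [prefix_count a q](prefix_count_split _ (fun i => u i == i)).
rewrite (@eq_prefix_count _ (predI c (predC _)) (fun i => u i < i)); last first.
  move=> i _ /=; have := uc i; case: eqP => [-> _|_ -> //]; first by rewrite ltnn andbF.
  by rewrite andbT.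
rewrite (@eq_prefix_count _ (predI a (predC _)) (fun i => (u^-1)%g i < i)); last first.
  move=> i _ /=; have := ua i; case: eqP => [e _|_ -> //]; last by rewrite andbT.
  by rewrite andbF -{1}e permK ltnn.
rewrite (@eq_prefix_count _ (predI c _) (predI (fun i => u i == i) c)); last first.
  by move=> i _ /=; rewrite andbC.
rewrite (@eq_prefix_count _ (predI a _) (predI (fun i => u i == i) a)); last first.
  by move=> i _ /=; rewrite andbC.
lia.
Qed.

Lemma prefix_count_image u A p q :
  prefix_count (fun i => A i && (u i < q)) p =
  prefix_count (fun j => A ((u^-1)%g j) && ((u^-1)%g j < p)) q.
Proof.
rewrite /prefix_count -[LHS](card_imset _ (@perm_inj _ u)).
apply: eq_card => j; rewrite !inE; apply/imsetP/idP => [[i + ->]|].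
  by rewrite inE permK => /and3P[-> -> ->].
by case/and3P=> ? ? ?; exists ((u^-1)%g j); rewrite ?inE permKV //; apply/and3P.
Qed.

(** Let N be the number of rows before [p] with value at least [q]; the rank is [p - N]. If N = 0,
    the sum is at least the number of exceedances, deficiencies and fixed points before [p], that is
    [p]. If N > 0, such a row [i0] makes every later smaller value a deficiency. Hence no exceedance
    with value below [q] starts at or after [p], no fixed point lies in [[p, q)], and [p - 1] is not
    fixed. So [p] is a boundary, the weights there are exact, and the sum is [p - N]. *)
Lemma compatible_rank_le u c a p q : avoids321 u -> compatible u c a ->
  p <= q <= n -> perm_rank u p q = minn (minn p q) (prefix_count c p + prefix_count a q).
Proof.
move=> u321 comp /andP[le_pq le_qn]; rewrite (compatible_exceedances _ _ comp).
have [_ _ /(_ p (leq_trans le_pq le_qn))[walk_le walk_eq]] := comp.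
rewrite /fixed_count /fixed_weight in walk_le walk_eq.
(* [exc] counts the rows of the exceedances among the first [p] rows, [exc']
   their columns among the first [q] columns. *)
set exc' := prefix_count (fun i => _ < i) q.
have exc'E : exc' = prefix_count (fun i => (i < u i) && (u i < q)) n.
  rewrite /exc' (prefix_count_image u (fun i : 'I_n => i < u i)).
  by apply: eq_prefix_count => i _; rewrite permKV ltn_ord andbT.
pose exc := prefix_count (fun i => i < u i) p.
have p_split : p =
    exc + prefix_count (fun i => u i < i) p + prefix_count (fun i => u i == i) p.
  rewrite -[LHS](@prefix_countT n) ?(leq_trans le_pq) //.
  rewrite (prefix_count_split _ (fun i => i < u i)) -addnA; congr (_ + _).
  rewrite (prefix_count_split _ (fun i => u i < i)); congr (_ + _).
    by apply: eq_prefix_count => i _ /=; lia.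
  by apply: eq_prefix_count => i _ /=; rewrite -val_eqE /=; lia.
have rank_split : p = perm_rank u p q + prefix_count (fun i => q <= u i) p.
  rewrite -[LHS](@prefix_countT n) ?(leq_trans le_pq) //.
  rewrite (prefix_count_split _ (fun i => u i < q)); congr (_ + _).
  by apply: eq_prefix_count => i _ /=; lia.
have exc_split : exc = prefix_count (fun i => (i < u i) && (u i < q)) p
                     + prefix_count (fun i => q <= u i) p.
  rewrite /exc (prefix_count_split _ (fun i => u i < q)); congr (_ + _).
  by apply: eq_prefix_count => i lt_ip /=; lia.
have le_exc' : prefix_count (fun i => (i < u i) && (u i < q)) p <= exc'.
  rewrite exc'E; apply/subset_leq_card/subsetP => i; rewrite !inE.
  by rewrite ltn_ord => /andP[].
have [N0|] := posnP (prefix_count (fun i => q <= u i) p).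
  have := prefix_count_diff (predI (fun i => u i == i) a) (introT andP (conj le_pq le_qn)).
  by lia.
case/card_gt0P=> i0.
rewrite inE => /andP[lt_i0p le_qi0].
have inv (j : 'I_n) : i0 < j -> u j < u i0 -> u j < j.
  exact: avoids321_deficiency.
have exc'_eq : exc' = prefix_count (fun i => (i < u i) && (u i < q)) p.
  rewrite exc'E; apply: eq_card => j; rewrite !inE ltn_ord /=.
  case: (ltnP j p) => //= le_pj; have := inv j; lia.
have fix_eq : prefix_count (predI (fun i => u i == i) a) q
            = prefix_count (predI (fun i => u i == i) a) p.
  apply: eq_card => j; rewrite !inE; case: eqP => [uj|]; last by rewrite !andbF.
  by have := inv j; rewrite uj; lia.
suff : run_boundary u p by move/walk_eq; lia.
right; have lt_pn : p.-1 < n by lia.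
exists (Ordinal lt_pn); split; last by right; rewrite /=; lia.
apply/eqP=> up; have := inv (Ordinal lt_pn); rewrite up /=.
case: (ltnP i0 p.-1) => [lt_i0|le_i0 _]; first by lia.
have ei0 : i0 = Ordinal lt_pn by apply: val_inj => /=; lia.
by move: le_qi0; rewrite ei0 up /=; lia.
Qed.

Lemma compatible_rank u c a p q : avoids321 u -> compatible u c a ->
  p <= n -> q <= n ->
  perm_rank u p q = minn (minn p q) (prefix_count c p + prefix_count a q).
Proof.
move=> u321 comp le_pn le_qn; case/orP: (leq_total p q) => [le_pq|le_qp].
  by apply: compatible_rank_le; rewrite ?le_pq.
rewrite -perm_rankV (@compatible_rank_le u^-1 a c) //.
- by rewrite [minn q p]minnC addnC.
- exact: avoids321V.
- exact: compatibleV.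
- by rewrite le_qp.
Qed.

Lemma compatible_card u c a : compatible u c a ->
  prefix_count c n + prefix_count a n = n.
Proof.
move=> comp; rewrite (compatible_exceedances _ _ comp).
case: comp => _ _ /(_ n (leqnn n))[_ /(_ (or_introl erefl))].
rewrite /fixed_weight => <-.
have -> : prefix_count (fun i => (u^-1)%g i < i) n = prefix_count (fun i => i < u i) n.
  transitivity (prefix_count (fun i => (i < u i) && (u i < n)) n); last first.
    by apply: eq_prefix_count => i _; rewrite ltn_ord andbT.
  rewrite (prefix_count_image u (fun i : 'I_n => i < u i)).
  by apply: eq_prefix_count => i _; rewrite permKV ltn_ord andbT.
rewrite -[RHS](@prefix_countT n) // (prefix_count_split predT (fun i => u i < i)) -addnA.
congr (_ + _); rewrite [RHS](prefix_count_split _ (fun i => i < u i)); congr (_ + _).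
  by apply: eq_prefix_count => i _ /=; lia.
by apply: eq_prefix_count => i _ /=; rewrite -val_eqE /=; lia.
Qed.

Lemma compatible_exists c a : prefix_count c n + prefix_count a n = n ->
  exists u, avoids321 u /\ compatible u c a.
Proof.
move=> card_ca.
pose h p q := minn (minn p q) (prefix_count c p + prefix_count a q).
have [u uE] : exists u : 'S_n, forall p q, p <= n -> q <= n -> perm_rank u p q = h p q.
  apply: perm_of_rank => [q|p|q|p|p q]; rewrite /h.
  - by rewrite min0n min0n.
  - by rewrite minn0 min0n.
  - move=> le_qn; have := @prefix_count_diff _ a q n.
    by rewrite le_qn leqnn => /(_ isT); lia.
  - move=> le_pn; have := @prefix_count_diff _ c p n.
    by rewrite le_pn leqnn => /(_ isT); lia.
  - move=> lt_pn lt_qn.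
    have /= -> := prefix_countS c (Ordinal lt_pn).
    have /= -> := prefix_countS a (Ordinal lt_qn).
    by case: (c _); case: (a _); rewrite /=; lia.
have u_row (i : 'I_n) q : q <= n -> h i.+1 q = h i q + (u i < q).
  by move=> le_qn; rewrite -!uE ?perm_rankSl // ltnW.
have u_col (j : 'I_n) p : p <= n -> h p j.+1 = h p j + ((u^-1)%g j < p).
  by move=> le_pn; rewrite -!uE ?perm_rankSr // ltnW.
have cS := prefix_countS c; have aS := prefix_countS a.
pose S p := prefix_count c p + prefix_count a p.
have fixedE i : (u i == i) = (i <= S i) && (i < S i.+1).
  have lt_in := ltn_ord i; rewrite -val_eqE /=.
  have := u_row i i (ltnW lt_in); have := u_row i i.+1 lt_in.
  by rewrite /h /S !cS !aS; case: (c i); case: (a i); rewrite /=; lia.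
exists u; split=> [i j k lt_ij lt_jk lt_u1 lt_u2|].
  (* Both sides of the middle point of a decreasing triple are unsaturated, so
     the rank is [c + a] around it, which cannot jump in the diagonal direction. *)
  have lt_jn := ltn_ord j; have lt_ujn := ltn_ord (u j).
  have ltS1 : h j (u j) < j.
    rewrite -uE ?(ltnW lt_jn) ?(ltnW lt_ujn) // -[X in _ < X](@prefix_countT n) ?(ltnW lt_jn) //.
    rewrite [X in _ < X](prefix_count_split _ (fun i => u i < u j)) -addn1.
    rewrite leq_add // card_gt0; apply/set0Pn; exists i.
    by rewrite !inE lt_ij /= -leqNgt ltnW.
  have ltS2 : h j (u j) < u j.
    rewrite -uE ?(ltnW lt_jn) ?(ltnW lt_ujn) // -perm_rankV.
    rewrite -[X in _ < X](@prefix_countT n) ?(ltnW lt_ujn) //.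
    rewrite [X in _ < X](prefix_count_split _ (fun i => (u^-1)%g i < j)) -addn1.
    rewrite leq_add // card_gt0; apply/set0Pn; exists (u k).
    by rewrite !inE permK lt_u2 /= -leqNgt ltnW.
  have := u_row j (u j) (ltnW lt_ujn); have := u_row j (u j).+1 lt_ujn.
  have := u_col (u j) j (ltnW lt_jn); rewrite permK !ltnn ltnSn.
  move: ltS1 ltS2; rewrite /h !cS !aS.
  by case: (c j); case: (a (u j)); rewrite /=; lia.
(* The surplus [fixed_weight - fixed_count] is the positive part of [S p - p]: it changes only at
   fixed indices, where [S] is saturated on both sides. *)
have walk p : p <= n -> fixed_count u p + maxn p (S p) = fixed_weight u c a p + p.
  elim: p => [|p IHp] lt_pn.
    by rewrite /fixed_count /fixed_weight /S !prefix_count0.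
  pose i := Ordinal lt_pn; have := IHp (ltnW lt_pn); have := fixedE i.
  rewrite /fixed_count /fixed_weight /S.
  have := prefix_countS (fun i => u i == i) i; rewrite [val i]/= => ->.
  have := prefix_countS (predI (fun i => u i == i) c) i; rewrite [val i]/= => ->.
  have := prefix_countS (predI (fun i => u i == i) a) i; rewrite [val i]/= => ->.
  have := cS i; rewrite [val i]/= => ->; have := aS i; rewrite [val i]/= => ->.
  rewrite /predI /=; case: (u i == i); case: (c i); case: (a i); rewrite /=; lia.
split=> [i|i|p le_pn].
- rewrite -val_eqE /=; have lt_in := ltn_ord i.
  have := u_row i i (ltnW lt_in); have := u_row i i.+1 lt_in.
  by rewrite /h !cS !aS; case: (c i); case: (a i); rewrite /=; lia.
- rewrite -permV_fixed -val_eqE /=; have lt_in := ltn_ord i.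
  have := u_col i i (ltnW lt_in); have := u_col i i.+1 lt_in.
  by rewrite /h !cS !aS; case: (c i); case: (a i); rewrite /=; lia.
have := walk p le_pn; split=> [|[pn|[i [ui ip]]]]; first by lia.
  by move: (walk n (leqnn n)); rewrite /S card_ca pn; lia.
(* A non-fixed [i] has [S i < i] or [S (i + 1) < i + 1]. As one step of [S] adds 0, 1 or 2, both
   [S i <= i] and [S (i + 1) <= i + 1] follow, so the surplus is 0 on both sides. *)
have := fixedE i; rewrite (negPf ui) => /esym/negbT.
by case: ip => ip; move: (walk p le_pn); rewrite /S -ip ?cS ?aS; case: (c i); case: (a i);
  rewrite /=; lia.
Qed.

End Compatible.

(** * Transversals of the blocks *)

(** Hall's condition for nested neighbourhoods. Greedy: match an element of largest key in [A] with
    one of largest key in [B]. The counts stay comparable because a threshold past the largest key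
    of [B] sees all of [B]. The map [f0] supplies values outside [A]. *)
Lemma key_matching (X Y : finType) (A : {set X}) (B : {set Y})
    (kx : X -> nat) (ky : Y -> nat) (f0 : X -> Y) :
    #|A| = #|B| ->
    (forall t, #|[set x in A | kx x <= t]| <= #|[set y in B | ky y <= t]|) ->
  exists f : X -> Y, [/\ {in A &, injective f}, {in A, forall x, f x \in B}
    & {in A, forall x, ky (f x) <= kx x}].
Proof.
have [k] := ubnP #|A|; elim: k A B => // k IHk A B lt_k eqAB le_AB.
have [A0|[x0 Ax0]] := set_0Vmem A.
  by exists f0; split=> [x y|x|x]; rewrite A0 inE.
have [y0 By0] : exists y, y \in B.
  by apply/set0Pn; rewrite -card_gt0 -eqAB card_gt0; apply/set0Pn; exists x0.
case: (@arg_maxnP _ x0 (mem A) kx Ax0) => x /= Ax max_x.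
case: (@arg_maxnP _ y0 (mem B) ky By0) => y /= By max_y.
have {}Ax : x \in A by []; have {}By : y \in B by [].
have full_A t : kx x <= t -> [set z in A | kx z <= t] = A.
  move=> le_t; apply/setP => z; rewrite inE; case Az: (z \in A) => //=.
  exact: leq_trans (max_x z Az) le_t.
have full_B t : ky y <= t -> [set z in B | ky z <= t] = B.
  move=> le_t; apply/setP => z; rewrite inE; case Bz: (z \in B) => //=.
  exact: leq_trans (max_y z Bz) le_t.
have le_yx : ky y <= kx x.
  have := le_AB (kx x); rewrite full_A // eqAB leqNgt; apply: contraNleq => lt_xy.
  apply/proper_card/properP; split; first by apply/subsetP=> z; rewrite inE => /andP[].
  by exists y => //; rewrite inE By leqNgt lt_xy.
have cardA' := cardsD1 x A; have cardB' := cardsD1 y B.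
rewrite Ax in cardA'; rewrite By in cardB'.
have le_sub (Z : finType) (C : {set Z}) (kz : Z -> nat) z t :
    [set z' in C :\ z | kz z' <= t] = [set z' in C | kz z' <= t] :\ z.
  by apply/setP=> z'; rewrite !inE andbA.
have [|||f [f_inj fB f_le]] := IHk (A :\ x) (B :\ y); [by lia..| |].
  move=> t; rewrite !le_sub.
  have cA := cardsD1 x [set z in A | kx z <= t].
  have cB := cardsD1 y [set z in B | ky z <= t].
  rewrite inE Ax /= in cA; rewrite inE By /= in cB.
  have := le_AB t; have := full_A t; have := full_B t.
  have maxA : #|[set z in A | kx z <= t]| <= #|A|.
    by apply/subset_leq_card/subsetP => z; rewrite inE => /andP[].
  case: (leqP (ky y) t) cB => /= le_y cB; case: (leqP (kx x) t) cA => /= le_x cA.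
  - by move=> /(_ isT) eB /(_ isT) eA _; rewrite eB in cB *; rewrite eA in cA *; lia.
  - move=> /(_ isT) eB _ _; rewrite eB in cB *.
    have : #|[set z in A | kx z <= t]| <= #|A :\ x|.
      apply/subset_leq_card/subsetP => z; rewrite !inE => /andP[-> le_z].
      by rewrite andbT; apply: contraTneq le_z => ->; rewrite -ltnNge.
    by lia.
  - by lia.
  - by lia.
exists (fun z => if z == x then y else f z); split=> [z z'|z|z] Az.
- move=> Az'; case: eqP => [->|/eqP zx]; case: eqP => [->|/eqP zx'] // eq_f.
  + by have := fB z'; rewrite !inE zx' Az' -eq_f eqxx => /(_ isT).
  + by have := fB z; rewrite !inE zx Az eq_f eqxx => /(_ isT).
  + by apply: f_inj; rewrite ?inE ?zx ?zx'.
- by case: eqP => // /eqP zx; have := fB z; rewrite !inE zx Az => /(_ isT)/andP[].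
- by case: eqP => [->//|/eqP zx]; apply: f_le; rewrite !inE zx.
Qed.

(** * Paired columns, reversal of values, and transversals *)

Section Columns.
Variable n : nat.
Implicit Types (v w : 'S_n) (I : {set 'I_(2 * n)}).

Lemma column_subproof (x : 'I_n * bool) :
  (if x.2 then n + x.1 else n.-1 - x.1) < 2 * n.
Proof. by case: x => i [] /=; have := ltn_ord i; lia. Qed.

(* Columns are paired symmetrically about the middle: [(i, true)] is the column
   n + i and [(i, false)] the column n - 1 - i. *)
Definition column x : 'I_(2 * n) := Ordinal (column_subproof x).

Lemma column_bij : bijective column.
Proof.
apply: inj_card_bij => [[i s] [j t]|]; last by rewrite card_prod !card_ord card_bool mulnC.
move/(congr1 val) => /=; have := ltn_ord i; have := ltn_ord j.
by case: s; case: t => ? ? /= e; try lia; congr pair; apply: val_inj => /=; lia.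
Qed.

Definition half_set I s : pred 'I_n := fun i => column (i, s) \in I.

Lemma card_pairs (A : pred ('I_n * bool)) p q :
  #|[set x : 'I_n * bool | (x.1 < if x.2 then p else q) && A x]|
  = prefix_count (fun i => A (i, true)) p + prefix_count (fun i => A (i, false)) q.
Proof.
have pair_inj (s : bool) : injective (fun i : 'I_n => (i, s)) by move=> i j [].
rewrite -(cardsID [set x | x.2]) /prefix_count; congr (_ + _).
  rewrite -[RHS](card_imset _ (pair_inj true)); apply: eq_card => -[i s].
  rewrite !inE; apply/idP/imsetP => [/andP[]|[j + [-> ->]]].
    by case: s => // /andP[? ?] _; exists i; rewrite ?inE //; apply/andP.
  by rewrite inE => ->.
rewrite -[RHS](card_imset _ (pair_inj false)); apply: eq_card => -[i s].
rewrite !inE; apply/idP/imsetP => [/andP[]|[j + [-> ->]]].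
  by case: s => // _ /andP[? ?]; exists i; rewrite ?inE //; apply/andP.
by rewrite inE => ->.
Qed.

Lemma card_halves I :
  #|I| = prefix_count (half_set I true) n + prefix_count (half_set I false) n.
Proof.
rewrite -(card_pairs (fun x => column x \in I)) -(card_imset _ (bij_inj column_bij)).
apply: eq_card => x; have [d columnK dK] := column_bij; apply/idP/imsetP.
  move=> xI; exists (d x) => //; rewrite inE dK xI andbT.
  by case: (d x).2; rewrite ltn_ord.
by case=> y + ->; rewrite inE => /andP[].
Qed.

Definition flip v : 'S_n := (v * perm (@rev_ord_inj n))%g.

Lemma flipE v i : flip v i = rev_ord (v i).
Proof. by rewrite permM permE. Qed.

Lemma flip_surj u : exists v, u = flip v.
Proof. by exists (u * (perm (@rev_ord_inj n))^-1)%g; rewrite /flip mulgKV. Qed.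

Lemma avoids123_flip v : avoids123 v <-> avoids321 (flip v).
Proof.
have flip_lt i j : (flip v j < flip v i) = (v i < v j).
  by rewrite !flipE /=; have := ltn_ord (v i); have := ltn_ord (v j); lia.
split=> [/existsPn v123 i j k lt_ij lt_jk|v321].
  rewrite !flip_lt => lt1 lt2; have := v123 i; move/existsPn/(_ j)/existsPn/(_ k)/negP.
  by apply; apply/and4P.
apply/existsPn => i; apply/existsPn => j; apply/existsPn => k; apply/negP.
by case/and4P=> lt_ij lt_jk lt1 lt2; apply: (v321 i j k); rewrite ?flip_lt.
Qed.

Lemma antifixed_flip v i : antifixed v i = (flip v i == i).
Proof. by rewrite flipE /antifixed -(inj_eq rev_ord_inj) rev_ordK. Qed.

Lemma corner_flip v p q : corner v p q = perm_rank (flip v) p (n - q).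
Proof.
apply: eq_prefix_count => i _; rewrite flipE /=.
by have := ltn_ord (v i); lia.
Qed.

Lemma corner_large v p q : corner v p q = corner v (minn p n) q.
Proof. by apply: eq_card => i; rewrite !inE; have := ltn_ord i; lia. Qed.

Lemma perm_rank_le_bruhat v w :
    (forall p q, p <= n -> q <= n ->
      perm_rank (flip w) p q <= perm_rank (flip v) p q) ->
  bruhat_le w v.
Proof.
move=> le_wv; apply: corner_le_bruhat => p q.
by rewrite corner_large (corner_large v) !corner_flip le_wv ?geq_minr ?leq_subr.
Qed.

(** A row [i < p] with reversed value below [q] has [n - q <= w i], so its column lies in
    [[n - q, n + p)]: it is [n + j] with [j < p] or [n - 1 - j] with [j < q]. *)
Lemma transversal_rank w I f p q : interval_transversal w I f -> p <= n -> q <= n ->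
  perm_rank (flip w) p q
    <= minn (minn p q) (prefix_count (half_set I true) p + prefix_count (half_set I false) q).
Proof.
case=> f_inj fI f_w le_pn le_qn; rewrite !leq_min -andbA; apply/and3P; split.
- by rewrite -[X in _ <= X](prefix_countT le_pn); apply: prefix_count_sub.
- rewrite -perm_rankV -[X in _ <= X](prefix_countT le_qn).
  exact: prefix_count_sub.
rewrite -(card_pairs (fun x => column x \in I)).
have [d columnK dK] := column_bij.
have df_inj : injective (d \o f) by apply: inj_comp => //; apply: can_inj dK.
rewrite /perm_rank /prefix_count -(card_imset _ df_inj).
apply/subset_leq_card/subsetP => _ /imsetP[i + ->].
rewrite !inE /= dK fI andbT flipE => /andP[lt_ip /= lt_q].
have := f_w i; rewrite -(dK (f i)); case: (d (f i)) => j s; rewrite columnK /=.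
by have := ltn_ord (w i); have := ltn_ord j; case: s => /=; lia.
Qed.

(** A deficient row [i] takes the right end [n + i] of its interval, and an exceeding row the left
    end [v i = n - 1 - u i]; compatibility puts both in [I]. The interval of a fixed row [i]
    consists of the columns of index at most [i] in both halves, so [key_matching] serves the fixed
    rows, with the walk inequality as Hall's condition. *)
Lemma compatible_transversal v I :
  compatible (flip v) (half_set I true) (half_set I false) ->
  exists f, interval_transversal v I f.
Proof.
set u := flip v => -[uc ua walk].
pose A := [set i | u i == i].
pose B := [set x : 'I_n * bool | (u x.1 == x.1) && (column x \in I)].
have cardA t : #|[set i in A | i <= t]| = fixed_count u t.+1.
  by apply: eq_card => i; rewrite !inE andbC ltnS.
have cardB t : #|[set x in B | x.1 <= t]|
    = fixed_weight u (half_set I true) (half_set I false) t.+1.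
  rewrite /fixed_weight -(card_pairs (fun x => (u x.1 == x.1) && (column x \in I))).
  by apply: eq_card => x; rewrite !inE if_same ltnS andbC.
(* Thresholds above [n] are outside the range of [walk]. *)
have large t : n <= t -> (fixed_count u t = fixed_count u n) *
    (fixed_weight u (half_set I true) (half_set I false) t
      = fixed_weight u (half_set I true) (half_set I false) n).
  by move=> le_nt; rewrite /fixed_count /fixed_weight !(prefix_count_full _ le_nt)
       !(prefix_count_full _ (leqnn n)).
have [||f [f_inj fB f_le]] := @key_matching _ _ A B val (fun x => val x.1)
  (fun i => (i, true)).
- transitivity (fixed_count u n); first by rewrite /fixed_count prefix_count_full.
  have [_ ->] := walk n (leqnn n); last by left.
  rewrite -(large n.+1 (leqnSn n)).2 -cardB; apply: eq_card => x; rewrite !inE.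
  by rewrite [x.1 <= n]ltnW ?andbT.
- move=> t; rewrite cardA cardB; have [le_nt|lt_tn] := leqP n t.+1.
    by rewrite !large //; case: (walk n).
  by case: (walk t.+1 (ltnW lt_tn)).
pose h i := if u i == i then f i else if u i < i then (i, true) else (u i, false).
have uu i : u i != i -> u (u i) != u i by apply: contra => /eqP/perm_inj->.
exists (column \o h); split=> [|i|i].
- apply: inj_comp; first exact: bij_inj column_bij.
  have fix_f i : u i == i -> u (f i).1 = (f i).1.
    by move=> ui; have := fB i; rewrite !inE => /(_ ui)/andP[/eqP].
  move=> i j; rewrite /h; case: (boolP (u i == i)) => ui; case: (boolP (u j == j)) => uj.
  + by apply: f_inj; rewrite inE.
  + have := fix_f i ui; case: ifP => _ + fE; rewrite fE /= => /eqP; first by rewrite (negPf uj).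
    by rewrite (negPf (uu j uj)).
  + have := fix_f j uj; case: ifP => _ + fE; rewrite -fE /= => /eqP; first by rewrite (negPf ui).
    by rewrite (negPf (uu i ui)).
  + by case: ifP => _; case: ifP => _ // [] // /perm_inj.
- rewrite /h /=; case: (boolP (u i == i)) => ui.
    by have := fB i; rewrite !inE => /(_ ui)/andP[].
  case: ifP => lt_ui; first by have := uc i ui; rewrite lt_ui /half_set.
  have := ua (u i) (uu i ui); rewrite permK /half_set => ->.
  by move: ui lt_ui; rewrite -val_eqE /=; lia.
have lt_in := ltn_ord i; have lt_vn := ltn_ord (v i).
have : u i = rev_ord (v i) by rewrite /u flipE.
rewrite /h /=; case: (boolP (u i == i)) => [/[dup] ui /eqP -> /(congr1 val) /=|ui].
  have := f_le i; rewrite inE => /(_ ui) /=.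
  by have := ltn_ord (f i).1; case: (f i).2; lia.
by move/(congr1 val) => /=; case: (u i < i) => /=; lia.
Qed.

End Columns.

Arguments half_set {n}.

(** * Catalan matroids *)

Section DyckWords.

(** Dyck suffixes starting at height [h], in a form that yields a recursion for their number. *)
Fixpoint ballot_word h (s : seq bool) :=
  match s with
  | [::] => h == 0
  | true :: s' => ballot_word h.+1 s'
  | false :: s' => (0 < h) && ballot_word h.-1 s'
  end.

Lemma ballot_wordP h (s : seq bool) : reflect
  ((forall k, k <= size s -> k <= h + 2 * count id (take k s)) /\
   size s = h + 2 * count id s) (ballot_word h s).
Proof.
elim: s h => [|b s IHs] h /=.
  by rewrite addn0; apply: (iffP eqP) => [->|[_ ->]//]; split=> // -[].
case: b; last first.
  apply: (iffP andP) => [[h_gt0 /IHs[le_k eq_s]]|[le_k eq_s]].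
    by split=> [[//|k] /= lt_k|]; [have := le_k k lt_k|]; lia.
  have h_gt0 : 0 < h by have := le_k 1 isT; rewrite /= take0 /=; lia.
  split=> //; apply/IHs; split=> [k lt_k|]; last by lia.
  by have := le_k k.+1 lt_k; rewrite /=; lia.
apply: (iffP (IHs _)) => [[le_k eq_s]|[le_k eq_s]].
  by split=> [[//|k] /= lt_k|]; [have := le_k k lt_k|]; lia.
split=> [k lt_k|]; last by lia.
by have := le_k k.+1 lt_k; rewrite /=; lia.
Qed.

Lemma height_count s : height s = ((2 * count id s)%:Z - (size s)%:Z)%R.
Proof.
rewrite /height; elim: s => [|b s IHs]; first by rewrite big_nil.
by rewrite big_cons IHs; case: b => /=; lia.
Qed.

Lemma is_dyck_ballot s : is_dyck s = ballot_word 0 s.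
Proof.
apply/andP/ballot_wordP => [[/forallP le_k /eqP eq_s]|[le_k eq_s]].
  split=> [k le_ks|]; last by move: eq_s; rewrite height_count; lia.
  have := le_k (Ordinal (le_ks : k < (size s).+1)).
  by rewrite height_count /= size_takel //; lia.
split; last by rewrite height_count; lia.
apply/forallP => k; have le_ks : k <= size s by rewrite -ltnS.
by rewrite height_count size_takel //; have := le_k k le_ks; lia.
Qed.

Definition ballot_count h N := #|[set t : N.-tuple bool | ballot_word h t]|.

Lemma ballot_count0 h : ballot_count h 0 = (h == 0).
Proof.
rewrite /ballot_count; case: eqP => [->|/eqP h_neq0].
  by rewrite -[RHS](card_tuple 0 bool) cardsE; apply: eq_card => t; rewrite !inE tuple0.
by apply: eq_card0 => t; rewrite inE tuple0 /=; apply: negbTE.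
Qed.

Lemma ballot_countS h N :
  ballot_count h N.+1 = ballot_count h.+1 N + (0 < h) * ballot_count h.-1 N.
Proof.
rewrite /ballot_count -(cardsID [set t : N.+1.-tuple bool | thead t]).
have cons_inj b : injective (fun t : N.-tuple bool => [tuple of b :: t]).
  by move=> t t' /(congr1 val) [] /val_inj.
congr (_ + _).
  rewrite -[RHS](card_imset _ (cons_inj true)); apply: eq_card => t.
  rewrite !inE; apply/andP/imsetP => [|[t' + ->]]; last by rewrite inE theadE.
  case: (tupleP t) => b t'; rewrite theadE => -[+ eb]; rewrite eb => t'P.
  by exists t'; rewrite ?inE.
have [h0|h_gt0] := posnP h.
  rewrite mul0n; apply: eq_card0 => t; rewrite !inE.
  by case: (tupleP t) => -[] t'; rewrite theadE //= h0.
rewrite mul1n -[RHS](card_imset _ (cons_inj false)); apply: eq_card => t.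
rewrite !inE; apply/andP/imsetP => [|[t' + ->]]; last by rewrite inE theadE /= h_gt0.
case: (tupleP t) => -[] t'; rewrite theadE => -[] // _ /andP[_ t'P].
by exists t'; rewrite ?inE.
Qed.

Lemma ballot_count_small h N : N < h -> ballot_count h N = 0.
Proof.
elim: N h => [|N IHN] h lt_N; first by rewrite ballot_count0; case: h lt_N.
by rewrite ballot_countS !IHN ?muln0 //; lia.
Qed.

(** The reflection formula, as a sum to avoid truncated subtraction; [k] is the number of upsteps.
    Induction on the length by Pascal's rule. *)
Lemma ballot_countE h k :
  ballot_count h (h + 2 * k) + (if k is k'.+1 then 'C(h + 2 * k, k') else 0)
  = 'C(h + 2 * k, k).
Proof.
have [N eN] : exists N, N = h + 2 * k by exists (h + 2 * k).
rewrite -eN.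
elim: N h k eN => [|N IHN] h k eN.
  have [-> ->] : k = 0 /\ h = 0 by lia.
  by rewrite ballot_count0.
rewrite ballot_countS; case: k eN => [|k] eN.
  have h_gt0 : 0 < h by lia.
  rewrite ballot_count_small ?h_gt0 ?mul1n; last by lia.
  by have := IHN h.-1 0; rewrite !bin0 => ->; lia.
have := IHN h.+1 k; have := IHN h.-1 k.+1; have [h0|h_gt0] := posnP h.
  (* From height 0 there is no downstep; the symmetry of row [N = 2k + 1] makes up for the missing
     term. *)
  have e : 'C(N, k.+1) = 'C(N, k).
    by rewrite -bin_sub; [congr 'C(_, _)|]; lia.
  by case: k eN e => [|k] eN e _ /(_ ltac:(lia));
    move: e; rewrite h0 mul0n !binS ?bin0; lia.
by case: k eN => [|k] eN /(_ ltac:(lia)) + /(_ ltac:(lia));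
  rewrite mul1n !binS ?bin0; lia.
Qed.

(** In product form, so that the division in [catalan_number] is seen to be exact. *)
Lemma ballot_count_catalan m :
  ballot_count 0 (2 * m) * m.+1 = 'C(2 * m, m).
Proof.
have := ballot_countE 0 m; rewrite add0n; case: m => [|m]; first by rewrite bin0; lia.
have := mul_bin_left (2 * m.+1) m; nia.
Qed.

Lemma card_catalan_matroid m : #|catalan_matroid m| = catalan_number m.
Proof.
have -> : #|catalan_matroid m| = ballot_count 0 (2 * m).
  rewrite card_imset => [|s t /setP eq_st]; last first.
    by apply/eq_from_tnth => i; have := eq_st i; rewrite !inE.
  by rewrite /ballot_count cardsE; apply: eq_card => t; rewrite !inE is_dyck_ballot.
by rewrite /catalan_number -ballot_count_catalan mulnK.
Qed.

Lemma catalan_number_gt0 m : 0 < catalan_number m.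
Proof.
rewrite /catalan_number -ballot_count_catalan mulnK //.
have := ballot_count_catalan m; have : 0 < 'C(2 * m, m) by rewrite bin_gt0; lia.
by case: (ballot_count 0 _) => //; lia.
Qed.

Lemma count_take_tnth N (t : N.-tuple bool) k : k <= N ->
  count id (take k t) = prefix_count (tnth t) k.
Proof.
elim: k => [|k IHk] lt_kN; first by rewrite take0 prefix_count0.
rewrite (take_nth false) ?size_tuple // -cats1 count_cat IHk 1?ltnW //.
by have /= -> := prefix_countS (tnth t) (Ordinal lt_kN); rewrite (tnth_nth false) addn0.
Qed.

Lemma mem_catalan_matroid m (B : {set 'I_(2 * m)}) : B \in catalan_matroid m <->
  (forall k, k <= 2 * m -> k <= 2 * prefix_count (mem B) k) /\
  prefix_count (mem B) (2 * m) = m.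
Proof.
have ballotE (t : (2 * m).-tuple bool) : is_dyck t <->
    (forall k, k <= 2 * m -> k <= 2 * prefix_count (tnth t) k) /\
    prefix_count (tnth t) (2 * m) = m.
  rewrite is_dyck_ballot; split=> [/ballot_wordP|[le_k eq_t]].
    rewrite size_tuple => -[le_k eq_t]; split=> [k le_km|].
      by rewrite -count_take_tnth // le_k.
    by rewrite -count_take_tnth // -{1}(size_tuple t) take_size; lia.
  apply/ballot_wordP; rewrite size_tuple; split=> [k le_km|].
    by rewrite count_take_tnth // le_k.
  have := count_take_tnth t (leqnn (2 * m)).
  by rewrite -{1}(size_tuple t) take_size; lia.
split=> [/imsetP[t]|BP].
  rewrite inE => /ballotE tP ->.
  have memE k : prefix_count (mem [set i | tnth t i]) k = prefix_count (tnth t) k.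
    by apply: eq_prefix_count => i _ /=; rewrite inE.
  by rewrite memE; split; case: tP => // le_k _ k; rewrite memE; apply: le_k.
have tE : tnth [tuple of [seq i \in B | i <- ord_tuple (2 * m)]] =1 mem B.
  by move=> i; rewrite tnth_map tnth_ord_tuple.
apply/imsetP; exists [tuple of [seq i \in B | i <- ord_tuple (2 * m)]].
  rewrite inE; apply/ballotE; have memE k := @eq_prefix_count _ _ _ k (fun i _ => tE i).
  by rewrite memE; split; case: BP => // le_k _ k; rewrite memE; apply: le_k.
by apply/setP => i; rewrite inE tE.
Qed.

End DyckWords.

(** * Reduced Catalan matroids *)

Section ReducedCatalan.
Variable l : nat.
Let m := l.+1.

Definition position (x : reduced_ground m) : nat := val (val x).
Definition position_count (B : {set reduced_ground m}) k :=
  #|[set x in B | position x < k]|.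

Implicit Types (B : {set reduced_ground m}) (C : {set 'I_(2 * m)}).

Let first : 'I_(2 * m) := Ordinal (isT : 0 < 2 * m).
Let last_subproof : (2 * m).-1 < 2 * m. Proof. by rewrite ltn_predL. Qed.
Let last : 'I_(2 * m) := Ordinal last_subproof.

Let lastS : last.+1 = 2 * m. Proof. by rewrite /= /m; lia. Qed.

Lemma reduced_prefix_count C k :
  prefix_count (mem C) k
  = ((0 < k) && (first \in C)) + (((2 * m).-1 < k) && (last \in C))
    + position_count [set x | val x \in C] k.
Proof.
rewrite /prefix_count (cardsD1 first) (cardsD1 last) !inE addnA.
have -> : last != first by rewrite -val_eqE /= /m; lia.
congr (_ + _ + _).
rewrite -[RHS](card_imset _ val_inj); apply: eq_card => i; rewrite !inE.
apply/idP/imsetP => [/and4P[i_last i_first lt_ik iC]|[x + ->]].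
  have i_in : 0 < i < (2 * m).-1.
    move: i_last i_first; rewrite -!val_eqE /=; have := ltn_ord i.
    by rewrite /m; lia.
  by exists (Sub i i_in : reduced_ground m); rewrite ?SubK // !inE SubK iC.
rewrite !inE => /andP[-> ->]; rewrite andbT -!val_eqE /=.
by have := valP x; rewrite /=; lia.
Qed.

(** With the initial upstep restored, the Dyck condition on the prefix of length 2k + 1 reads
    [k <= position_count B (2k + 1)]. Prefixes of even length follow from the odd ones just before
    them. *)
Lemma mem_reduced_catalan B : B \in reduced_catalan_matroid m <->
  #|B| = l /\
  forall k : 'I_m, k <= position_count B (2 * k).+1.
Proof.
have full_B : position_count B (2 * m) = #|B|.
  congr #|pred_of_set _|; by apply/setP => x; rewrite inE ltn_ord andbT.
split=> [/imsetP[C /mem_catalan_matroid[le_k eq_C] BE]|[cardB le_k]].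
  have pC := reduced_prefix_count C; rewrite -BE in pC.
  have firstC : first \in C.
    have := le_k 1 isT; have := prefix_countS (mem C) first.
    by rewrite prefix_count0 /= => ->; case: (first \in C).
  (* The prefix of length 2m - 1 already needs all m upsteps. *)
  have lastC : (last \in C) = false.
    have := le_k _ (ltnW last_subproof); have := prefix_countS (mem C) last.
    rewrite lastS eq_C /=; case: (last \in C) => //=; lia.
  rewrite firstC lastC in pC; split=> [|k].
    by have := pC (2 * m); rewrite eq_C full_B andbF /m; lia.
  have := le_k (2 * k).+1; rewrite pC andbF addn0 /=.
  by rewrite ltn_pmul2l // ltn_ord => /(_ isT); lia.
pose C := first |: [set val x | x in B].
have BE : B = [set x : reduced_ground m | val x \in C].
  apply/setP => x; rewrite !inE (mem_imset _ _ val_inj).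
  by case: eqP => // x0; have := valP x; rewrite /= x0.
apply/imsetP; exists C => //; apply/mem_catalan_matroid.
have pC := reduced_prefix_count C; rewrite -BE in pC.
have firstC : first \in C by rewrite !inE eqxx.
have lastC : (last \in C) = false.
  apply/negP; rewrite !inE => /orP[/eqP/(congr1 val)|/imsetP[x _ /(congr1 val)]] /=.
    by rewrite /m; lia.
  by have := valP x; rewrite /=; lia.
rewrite firstC lastC in pC; split=> [k le_km|]; last first.
  by rewrite pC full_B cardB andbF /m; lia.
rewrite pC andbT andbF addn0; case: k le_km => // k le_km.
have lt_k2 : k./2 < m by rewrite /m; lia.
have := le_k (Ordinal lt_k2) => /=.
suff : position_count B (2 * k./2).+1 <= position_count B k.+1.
  by lia.
apply/subset_leq_card/subsetP => x; rewrite !inE => /andP[-> /=]; lia.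
Qed.

Lemma card_reduced_catalan : #|reduced_catalan_matroid m| = catalan_number m.
Proof.
rewrite -card_catalan_matroid; apply: card_in_imset => C C'.
move=> /mem_catalan_matroid[le_k eq_C] /mem_catalan_matroid[le_k' eq_C'] /setP eqCC'.
have firstC D : (forall k, k <= 2 * m -> k <= 2 * prefix_count (mem D) k) -> first \in D.
  move/(_ 1 isT); have := prefix_countS (mem D) first.
  by rewrite prefix_count0 /= => ->; case: (first \in D).
have lastC (D : {set 'I_(2 * m)}) :
    (forall k, k <= 2 * m -> k <= 2 * prefix_count (mem D) k) ->
    prefix_count (mem D) (2 * m) = m -> (last \in D) = false.
  move=> le_D eq_D; have := le_D _ (ltnW last_subproof).
  have := prefix_countS (mem D) last.
  rewrite lastS eq_D /=; case: (last \in D) => //=; lia.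
apply/setP => i; have [i_in|] := boolP (0 < i < (2 * m).-1).
  by have := eqCC' (Sub i i_in : reduced_ground m); rewrite !inE SubK.
have lt_im := ltn_ord i; have [i0 _|i_gt0 i_last] := posnP i.
  by have -> : i = first by [apply: val_inj]; rewrite !firstC.
have -> : i = last by apply: val_inj; rewrite /=; lia.
by rewrite !lastC.
Qed.

End ReducedCatalan.

(** * Matroid constructions *)

Section Matroids.

Lemma mem_set_ext (T : finType) (M : {set {set T}}) (A B : {set T}) :
  A \in M -> A =i B -> B \in M.
Proof. by move=> AM /setP <-. Qed.

(** These are nested matroids. To replace [a], take [b] of least key in [B] minus [A]. If a
    threshold excludes [b], every element of [B] below it lies in [A] and differs from [a], so the
    bound for [B] passes to the new set. *)
Lemma ballot_matroid (T : finType) (J : Type) (key : T -> nat) (r : nat)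
    (bound threshold : J -> nat) (M : {set {set T}}) :
    M != set0 ->
    (forall B, B \in M <-> #|B| = r /\
      forall j, bound j <= #|[set x in B | key x < threshold j]|) ->
  is_matroid M.
Proof.
move=> M_neq0 memM; split=> // A B /memM[cardA le_A] /memM[cardB le_B] a.
rewrite inE => /andP[aB aA].
have card_sub : #|B :\: A| = #|A :\: B|.
  by have := cardsID A B; have := cardsID B A; rewrite setIC; lia.
have [b0 b0P] : exists b, b \in B :\: A.
  apply/set0Pn; rewrite -card_gt0 card_sub card_gt0; apply/set0Pn.
  by exists a; rewrite inE aB.
case: (@arg_minnP _ b0 (mem (B :\: A)) key b0P) => b /= bP min_b.
have := bP; rewrite inE => /andP[bA bB].
have ne_ba : b != a by apply: contraNneq bA => ->.
exists b; first by rewrite inE bA.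
apply/memM; split=> [|j].
  by rewrite cardsU1 !inE (negPf bA) andbF /= -cardA (cardsD1 a A) aA.
set t := threshold j.
have -> : [set x in b |: A :\ a | key x < t]
        = (if key b < t then [set b] else set0) :|: [set x in A | key x < t] :\ a.
  apply/setP => x; rewrite !inE; case: (eqVneq x b) => [->|ne_xb] /=.
    by case: ifP => _; rewrite !inE ?eqxx // (negPf bA) !andbF.
  by case: ifP => _; rewrite !inE ?(negPf ne_xb) //= andbA.
have cardA' := cardsD1 a [set x in A | key x < t].
rewrite inE aA /= in cardA'; have := le_A j; have := le_B j; rewrite -/t.
case: ifP => [lt_b|ge_b].
  by rewrite cardsU1 !inE (negPf bA) ?andbF /= ?andbF /=; lia.
rewrite set0U; case: (key a < t) cardA' => cardA'; last by lia.
suff : #|[set x in B | key x < t]| <= #|[set x in A | key x < t] :\ a| by lia.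
apply/subset_leq_card/subsetP => x; rewrite !inE => /andP[xB lt_x].
rewrite lt_x andbT; apply/andP; split; first by apply: contraNneq aB => <-.
apply: contraFT ge_b => xA; apply: leq_ltn_trans lt_x.
by apply: min_b; rewrite inE xA.
Qed.

Lemma singleton_matroid (T : finType) (B : {set T}) : is_matroid [set B].
Proof.
split; first by apply/set0Pn; exists B; rewrite inE.
by move=> A C /set1P-> /set1P-> a; rewrite setDv inE.
Qed.

Lemma direct_sum_matroid (I : finType) (T : I -> finType)
    (M : forall i, {set {set T i}}) :
  (forall i, is_matroid (M i)) -> is_matroid (direct_sum M).
Proof.
move=> matM; split.
  have [B BM] : exists B : forall i, {set T i}, forall i, B i \in M i.
    apply: (@fin_all_exists _ (fun i => {set T i}) (fun i B => B \in M i)) => i.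
    by case: (matM i) => /set0Pn.
  apply/set0Pn; exists [set u | tagged u \in B (tag u)].
  rewrite inE; apply/forallP => i.
  by rewrite (_ : [set x | _] = B i) //; apply/setP => x; rewrite !inE.
move=> A B; rewrite !inE => /forallP AM /forallP BM [i x].
rewrite inE => /andP[xB xA].
have [|y] := (matM i).2 _ _ (AM i) (BM i) x; first by rewrite !inE xB.
rewrite !inE => yBA exch; exists (Tagged T y); first by rewrite inE.
rewrite inE; apply/forallP => j; have [eq_ij|ne_ij] := eqVneq i j.
  case: j / eq_ij; apply: (mem_set_ext exch) => z; rewrite !inE.
  by rewrite -!/(Tagged T _) !eq_Tagged.
apply: (mem_set_ext (AM j)) => z; rewrite !inE.
have ne w : (Tagged T z == Tagged T (w : T i)) = false.
  by apply/eqP => /(congr1 tag) /= eji; rewrite eji eqxx in ne_ij.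
by rewrite !ne.
Qed.

Lemma direct_sum2_matroid (T1 T2 : finType) (M1 : {set {set T1}}) (M2 : {set {set T2}}) :
  is_matroid M1 -> is_matroid M2 -> is_matroid (direct_sum2 M1 M2).
Proof.
case=> /set0Pn[B1 B1M] exch1 [/set0Pn[B2 B2M] exch2]; split.
  apply/set0Pn; exists [set u | match u with inl x => x \in B1 | inr y => y \in B2 end].
  rewrite inE; apply/andP; split; [apply: (mem_set_ext B1M) | apply: (mem_set_ext B2M)];
    by move=> x; rewrite !inE.
move=> A B; rewrite !inE => /andP[A1 A2] /andP[C1 C2] [] x; rewrite inE => /andP[xB xA].
  have [|y] := exch1 _ _ A1 C1 x; first by rewrite !inE xB.
  rewrite !inE => yBA exch; exists (inl y); first by rewrite inE.
  rewrite inE; apply/andP; split; [apply: (mem_set_ext exch) | apply: (mem_set_ext A2)];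
    by move=> z; rewrite !inE.
have [|y] := exch2 _ _ A2 C2 x; first by rewrite !inE xB.
rewrite !inE => yBA exch; exists (inr y); first by rewrite inE.
rewrite inE; apply/andP; split; [apply: (mem_set_ext A1) | apply: (mem_set_ext exch)];
  by move=> z; rewrite !inE.
Qed.

Lemma card_direct_sum (I : finType) (T : I -> finType) (M : forall i, {set {set T i}}) :
  #|direct_sum M| = \prod_i #|M i|.
Proof.
rewrite -cardsXn.
pose f (B : {dffun forall i, {set T i}}) := [set u : {i & T i} | tagged u \in B (tag u)].
have f_inj : injective f.
  move=> B C /setP eqBC; apply/ffunP => i; apply/setP => x.
  by have := eqBC (Tagged T x); rewrite !inE.
rewrite -(card_imset _ f_inj); apply: eq_card => B; apply/idP/imsetP => [|[C + ->]].
  rewrite inE => /forallP BM; exists [ffun i => [set x | Tagged T x \in B]].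
    by apply/setXnP => i; rewrite ffunE; apply: BM.
  by apply/setP => -[i x]; rewrite !inE ffunE inE.
move/setXnP => CM; rewrite inE; apply/forallP => i.
by apply: (mem_set_ext (CM i)) => x; rewrite !inE.
Qed.

Lemma card_direct_sum2 (T1 T2 : finType) (M1 : {set {set T1}}) (M2 : {set {set T2}}) :
  #|direct_sum2 M1 M2| = #|M1| * #|M2|.
Proof.
rewrite -cardsX.
pose f (B : {set T1 + T2}) := ([set x | inl x \in B], [set y | inr y \in B]).
have f_inj : injective f.
  move=> B C [/setP eq1 /setP eq2]; apply/setP => -[x|y].
    by have := eq1 x; rewrite !inE.
  by have := eq2 y; rewrite !inE.
rewrite -(card_imset _ f_inj); apply: eq_card => -[B1 B2].
apply/imsetP/idP => [[B + ->]|]; first by rewrite !inE.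
rewrite inE /= => /andP[B1M B2M].
pose B : {set T1 + T2} :=
  [set u | match u with inl x => x \in B1 | inr y => y \in B2 end].
have BE : f B = (B1, B2) by congr pair; apply/setP => x; rewrite !inE.
by exists B => //; rewrite inE; case: BE => -> ->; rewrite B1M.
Qed.

Section Preimage.
Variables (T1 T2 : finType) (h : T2 -> T1).
Variables (M1 : {set {set T1}}) (M2 : {set {set T2}}).
Hypotheses (h_bij : bijective h) (hM : forall B, (B \in M1) = (h @^-1: B \in M2)).

Lemma preimage_matroid : is_matroid M2 -> is_matroid M1.
Proof.
have [d hK dK] := h_bij; case=> /set0Pn[B BM] exch; split.
  apply/set0Pn; exists (h @: B); rewrite hM; apply: (mem_set_ext BM) => x.
  by rewrite inE mem_imset //; apply: can_inj hK.
move=> A C; rewrite !hM => AM CM a; rewrite inE => /andP[aC aA].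
have [|b] := exch _ _ AM CM (d a); first by rewrite !inE dK aC.
rewrite !inE => bCA bM; exists (h b); first by rewrite inE.
rewrite hM; apply: (mem_set_ext bM) => x.
by rewrite !inE (inj_eq (can_inj hK)) -(can_eq hK x (d a)) dK.
Qed.

Lemma preimage_matroid_iso : matroid_iso M1 M2.
Proof.
have [d hK dK] := h_bij; exists d; first by exists h.
have imE (B : {set T1}) : d @: B = h @^-1: B.
  apply/setP => x; rewrite inE -[x in LHS]hK mem_imset //; exact: can_inj dK.
apply/setP => B; apply/idP/imsetP => [BM|[C CM ->]]; last by rewrite imE -hM.
have hB : h @^-1: (h @: B) = B.
  by apply/setP => x; rewrite inE mem_imset //; apply: can_inj hK.
by exists (h @: B); rewrite ?hM ?imE hB.
Qed.

Lemma card_preimage_matroid : #|M1| = #|M2|.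
Proof.
have [d d_bij ->] := preimage_matroid_iso.
by rewrite card_imset //; apply: imset_inj; apply: bij_inj.
Qed.

End Preimage.

Lemma reduced_catalan_is_matroid l : is_matroid (reduced_catalan_matroid l.+1).
Proof.
apply: (@ballot_matroid _ 'I_l.+1 (@position l) l (fun k => k) (fun k => (2 * k).+1)).
  by rewrite -card_gt0 card_reduced_catalan catalan_number_gt0.
exact: mem_reduced_catalan.
Qed.

End Matroids.

(** * Runs of antifixed points *)

Lemma inj_surj_bij (T1 T2 : finType) (f : T1 -> T2) :
  injective f -> (forall y, exists x, f x = y) -> bijective f.
Proof.
move=> f_inj f_surj; have [d dK] := fin_all_exists f_surj.
by exists d => // x; apply: f_inj; rewrite dK.
Qed.

Section Runs.
Variables (n : nat) (v : 'S_n).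
Implicit Types (r s : 'I_n * 'I_n) (i : 'I_n).

Lemma max_run_le r : r \in max_antifixed_runs v -> r.1 <= r.2.
Proof. by rewrite inE => /andP[/andP[]]. Qed.

Lemma max_run_length r : r \in max_antifixed_runs v -> r.1 + run_length r = r.2.+1.
Proof. by move=> /max_run_le le_r; rewrite /run_length addnS subnKC. Qed.

Lemma max_run_antifixed r i :
  r \in max_antifixed_runs v -> r.1 <= i <= r.2 -> antifixed v i.
Proof. by rewrite inE => /andP[/andP[_ /forallP/(_ i)/implyP]]. Qed.

Lemma max_run_maximal r s : r \in max_antifixed_runs v ->
  (forall i, s.1 <= i <= s.2 -> antifixed v i) -> s.1 <= r.1 -> r.2 <= s.2 -> s = r.
Proof.
move=> r_max s_run le1 le2; have := r_max; rewrite inE => /andP[_ /forallP/(_ s)].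
rewrite le1 le2 !andbT => /implyP sr; apply/eqP/sr/andP; split.
  exact: leq_trans le1 (leq_trans (max_run_le r_max) le2).
by apply/forallP => i; apply/implyP/s_run.
Qed.

Lemma max_run_start r i : r \in max_antifixed_runs v -> i.+1 = r.1 -> ~~ antifixed v i.
Proof.
move=> r_max ir; apply/negP => vi.
suff e : (i, r.2) = r by have := congr1 (fun s => nat_of_ord s.1) e; rewrite /=; lia.
apply: max_run_maximal => //= [j /andP[le1 le2]|]; last by rewrite -ir.
have [eij|ne_ij] := eqVneq j i; first by rewrite eij.
apply: (max_run_antifixed r_max); rewrite le2 andbT -ir.
by rewrite ltn_neqAle le1 andbT eq_sym.
Qed.

Lemma max_run_end r i : r \in max_antifixed_runs v -> i = r.2.+1 :> nat -> ~~ antifixed v i.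
Proof.
move=> r_max ir; apply/negP => vi.
suff e : (r.1, i) = r by have := congr1 (fun s => nat_of_ord s.2) e; rewrite /=; lia.
apply: max_run_maximal => //= [j /andP[le1 le2]|]; last by rewrite ir.
have [eij|ne_ij] := eqVneq j i; first by rewrite eij.
apply: (max_run_antifixed r_max); rewrite le1 -ltnS -ir.
by rewrite ltn_neqAle le2 andbT.
Qed.

Lemma max_run_exists i : antifixed v i ->
  exists2 r, r \in max_antifixed_runs v & r.1 <= i <= r.2.
Proof.
move=> vi; pose D := [pred r : 'I_n * 'I_n | antifixed_run v r && (r.1 <= i <= r.2)].
have D0 : D (i, i).
  rewrite /= /antifixed_run /= !leqnn !andbT; apply/forallP => j; apply/implyP.
  by rewrite -eqn_leq => /eqP/val_inj <-.
case: (@arg_maxnP _ (i, i) D (fun r => r.2 - r.1) D0) => r /= /andP[r_run ir] r_max.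
exists r => //; rewrite inE r_run; apply/forallP => s; apply/implyP => /and3P[s_run le1 le2].
have := r_max s; rewrite s_run; have := s_run; have := r_run => /andP[+ _] /andP[+ _].
move=> ler les; case/andP: ir => /(leq_trans le1)-> /leq_trans->//.
move=> /(_ isT) le_rs; case: r s le1 le2 ler les le_rs {r_run r_max s_run}.
move=> r1 r2 [s1 s2] /= le1 le2 ler les le_rs.
by apply/eqP; congr pair; apply: val_inj => /=; lia.
Qed.

(** The union of two runs sharing [i] is a run containing both, so it equals each of them by
    maximality. *)
Lemma max_run_unique r s i :
    r \in max_antifixed_runs v -> s \in max_antifixed_runs v ->
    r.1 <= i <= r.2 -> s.1 <= i <= s.2 -> r = s.
Proof.
move=> r_max s_max ir is_.
pose t := (if r.1 <= s.1 then r.1 else s.1, if r.2 <= s.2 then s.2 else r.2).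
have t_run (j : 'I_n) : t.1 <= j <= t.2 -> antifixed v j.
  rewrite /t /= => jt; have [ij|ij] := leqP j i.
    case: ifP jt => _ jt; [apply: (max_run_antifixed r_max)|
      apply: (max_run_antifixed s_max)]; lia.
  case: ifP jt => _; case: ifP => le2 jt.
  - by apply: (max_run_antifixed s_max); lia.
  - by apply: (max_run_antifixed r_max); lia.
  - by apply: (max_run_antifixed s_max); lia.
  - by apply: (max_run_antifixed r_max); lia.
have <- : t = r by apply: max_run_maximal => //; rewrite /t /=; case: ifP => //; lia.
by apply: max_run_maximal => //; rewrite /t /=; case: ifP => //; lia.
Qed.

Definition run_type := {r : 'I_n * 'I_n | r \in max_antifixed_runs v}.
Definition run_ground := {r : run_type & reduced_ground (run_length (val r)).+1}.
Definition free_ground := {x : 'I_n * bool | ~~ antifixed v x.1}.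

(* The element 1 + 2k + s of the ground set of a run starting at [a] stands for
   the column of index a + k in the half [s]. *)
Definition run_pair (r : run_type) (x : reduced_ground (run_length (val r)).+1) :=
  (insubd (val r).1 ((val r).1 + (position x).-1./2), odd (position x).-1).

Definition pair_of (z : run_ground + free_ground) : 'I_n * bool :=
  match z with inl y => run_pair (tagged y) | inr y => val y end.

Lemma position_bound l (x : reduced_ground l.+1) : 0 < position x <= 2 * l.
Proof. by have := valP x; rewrite /position /=; lia. Qed.

Lemma position_inj l : injective (@position l).
Proof. by move=> x y /val_inj/val_inj. Qed.

(** The index stays inside the run, so the default of [insubd] is never taken. *)
Lemma run_pairE (r : run_type) (x : reduced_ground (run_length (val r)).+1) :
  val (run_pair x).1 = (val r).1 + (position x).-1./2.
Proof.
rewrite /run_pair val_insubd ifT //.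
have := position_bound x; have := max_run_le (valP r); have := ltn_ord (val r).2.
by rewrite /run_length /=; lia.
Qed.

Lemma run_pair_in (r : run_type) (x : reduced_ground (run_length (val r)).+1) :
  (val r).1 <= (run_pair x).1 <= (val r).2.
Proof.
rewrite run_pairE; have := position_bound x; have := max_run_le (valP r).
by rewrite /run_length /=; lia.
Qed.

Lemma run_pair_inj (r : run_type) : injective (@run_pair r).
Proof.
move=> x y eq_xy; apply: position_inj.
have := congr1 (fun z => val z.1) eq_xy; rewrite !run_pairE => /addnI eq_half.
have eq_odd : odd (position x).-1 = odd (position y).-1 := congr1 snd eq_xy.
have /andP[x_gt0 _] := position_bound x; have /andP[y_gt0 _] := position_bound y.
rewrite -(prednK x_gt0) -(prednK y_gt0) -(odd_double_half (position x).-1).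
by rewrite eq_half eq_odd odd_double_half.
Qed.

Lemma run_pair_surj (r : run_type) (y : 'I_n * bool) :
  (val r).1 <= y.1 <= (val r).2 -> exists x, @run_pair r x = y.
Proof.
move=> yr; pose p := (y.2 + (y.1 - (val r).1).*2).+1.
have lt_p : p < 2 * (run_length (val r)).+1.
  by rewrite /p /run_length; case: y.2; lia.
have p_in : 0 < p < (2 * (run_length (val r)).+1).-1.
  by rewrite /p /run_length; case: y.2; lia.
have [x pE] : exists x : reduced_ground (run_length (val r)).+1, position x = p.
  by exists (Sub (Ordinal lt_p) p_in).
exists x; rewrite [LHS]surjective_pairing [RHS]surjective_pairing; congr pair; last first.
  by rewrite /run_pair /= pE /= oddD odd_double addbF oddb.
by apply: val_inj; rewrite run_pairE pE /= half_bit_double subnKC //; case/andP: yr.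
Qed.

(** The odd thresholds of [mem_reduced_catalan] cut out exactly the first [k] indices of the run, in
    both halves. *)
Lemma run_pair_lt (r : run_type) (x : reduced_ground (run_length (val r)).+1) k :
  ((run_pair x).1 < (val r).1 + k) = (position x < (2 * k).+1).
Proof.
rewrite [nat_of_ord _]run_pairE ltn_add2l; have /andP[+ _] := position_bound x.
by case: (position x) => // p _; rewrite ltnS mul2n ltn_half_double.
Qed.

Lemma pair_of_bij : bijective pair_of.
Proof.
apply: inj_surj_bij => [[[r x]|y] [[r' x']|y']|y] /=.
- move=> eq_xx'; have err : r = r'.
    apply: val_inj; apply: (max_run_unique (valP r) (valP r') (run_pair_in x)).
    by rewrite eq_xx' run_pair_in.
  by case: r' / err x' eq_xx' => x' /run_pair_inj ->.
- move=> e; have := valP y'; rewrite /= -e => /negP; case.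
  exact: max_run_antifixed (valP r) (run_pair_in x).
- move=> e; have := valP y; rewrite /= e => /negP; case.
  exact: max_run_antifixed (valP r') (run_pair_in x').
- by move/val_inj->.
have [yfix|yfree] := boolP (antifixed v y.1).
  have [r r_max yr] := max_run_exists yfix.
  have [x xE] := @run_pair_surj (Sub r r_max) y yr.
  by exists (inl (Tagged (fun r : run_type => reduced_ground (run_length (val r)).+1) x)).
by exists (inr (Sub y yfree)).
Qed.

Definition column_of z := column (pair_of z).

Lemma column_of_bij : bijective column_of.
Proof. exact: bij_comp (@column_bij n) pair_of_bij. Qed.

Let u := flip v.

Lemma max_run_count r k : r \in max_antifixed_runs v -> k <= run_length r ->
  fixed_count u (r.1 + k) = fixed_count u r.1 + k.
Proof.
move=> r_max; elim: k => [|k IHk] lt_k; first by rewrite !addn0.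
have lt_rk : r.1 + k < n.
  by have := max_run_le r_max; have := ltn_ord r.2; move: lt_k; rewrite /run_length; lia.
rewrite addnS; have /= := prefix_countS (fun i => u i == i) (Ordinal lt_rk).
rewrite /fixed_count => ->; rewrite -/(fixed_count _ _) IHk 1?ltnW //.
rewrite -antifixed_flip (max_run_antifixed r_max) ?addn1 ?addnS //=.
by have := max_run_le r_max; move: lt_k; rewrite /run_length; lia.
Qed.

Variable I : {set 'I_(2 * n)}.
Let W := fixed_weight u (half_set I true) (half_set I false).

Definition run_slice (r : run_type) : {set reduced_ground (run_length (val r)).+1} :=
  [set x | column (run_pair x) \in I].

Lemma max_run_weight (r : run_type) k : k <= run_length (val r) ->
  W ((val r).1 + k) = W (val r).1 + position_count (run_slice r) (2 * k).+1.
Proof.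
move=> le_k; pose A (y : 'I_n * bool) := (u y.1 == y.1) && (column y \in I).
have WE p : W p = #|[set y : 'I_n * bool | (y.1 < p) && A y]|.
  rewrite [LHS](esym (@card_pairs n A p p)).
  by apply: eq_card => y; rewrite !inE if_same.
rewrite !WE -(cardsID [set y : 'I_n * bool | y.1 < (val r).1]); congr (_ + _).
  by apply: eq_card => y; rewrite !inE; lia.
rewrite -[RHS](card_imset _ (@run_pair_inj r)).
apply: eq_card => y; rewrite !inE; apply/idP/imsetP => [/and3P[ge_y lt_y]|[x + ->]].
  case/andP=> _ yI.
  have [|x xy] := @run_pair_surj r y.
    rewrite leqNgt ge_y /=; have := max_run_le (valP r).
    by move: lt_y le_k; rewrite /run_length /=; lia.
  by exists x; rewrite // !inE -run_pair_lt xy yI.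
rewrite !inE -run_pair_lt => /andP[xI lt_x].
rewrite /A xI lt_x !andbT -antifixed_flip -leqNgt.
rewrite (max_run_antifixed (valP r)) ?run_pair_in //.
by rewrite !andbT; case/andP: (run_pair_in x).
Qed.

Lemma run_slice_reduced_catalan (r : run_type) (a := val (val r).1) :
  run_slice r \in reduced_catalan_matroid (run_length (val r)).+1 <->
  (forall k, k <= run_length (val r) -> W a + k <= W (a + k)) /\
  W (a + run_length (val r)) = W a + run_length (val r).
Proof.
have cardE : #|run_slice r| = position_count (run_slice r) (2 * run_length (val r)).+1.
  by apply: eq_card => x; rewrite !inE ltnS; case/andP: (position_bound x) => _ ->; rewrite andbT.
split=> [/mem_reduced_catalan[cardS le_k]|[le_k eq_W]].
  split=> [k lt_k|]; last by rewrite max_run_weight // -cardE cardS.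
  by rewrite max_run_weight // leq_add2l (le_k (Ordinal (lt_k : k < _.+1))).
apply/mem_reduced_catalan; split=> [|k].
  by apply/eqP; rewrite cardE -(eqn_add2l (W a)) -max_run_weight // eq_W.
rewrite -(leq_add2l (W a)) -max_run_weight ?le_k //; by rewrite -ltnS ltn_ord.
Qed.

Definition free_basis : {set free_ground} :=
  [set y : free_ground |
    if (val y).2 then u (val y).1 < (val y).1 else (u^-1)%g (val y).1 < (val y).1].

(** The walk over fixed points stands still between runs and is 0 there, so its conditions separate
    into one excursion per run. Conversely they are recovered by strong induction on the
    position. *)
Lemma compatible_direct_sum :
  compatible u (half_set I true) (half_set I false) <->
  column_of @^-1: I \in direct_sum2 (run_catalan_sum v) [set free_basis].
Proof.
rewrite inE inE; have runs_eq (r : run_type) :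
    [set x | Tagged (fun r : run_type => reduced_ground (run_length (val r)).+1) x
      \in [set z | inl z \in column_of @^-1: I]] = run_slice r.
  by apply/setP => x; rewrite !inE.
(* Equality is asked only at boundaries up to the start of the run, so that the induction hypothesis
   below can supply it. *)
have start (r : run_type) : (forall p, p <= n -> run_boundary u p -> p <= (val r).1 ->
    fixed_count u p = W p) -> fixed_count u (val r).1 = W (val r).1.
  move=> bound; case ra: (val (val r).1) => [|q].
    by rewrite /fixed_count /W /fixed_weight !prefix_count0.
  have lt_qn : q < n by rewrite -ra ltnW // ltn_ord.
  rewrite -ra; apply: bound => //; first by rewrite ltnW // ltn_ord.
  right; exists (Ordinal lt_qn); rewrite -antifixed_flip; split; last by right; rewrite ra.
  by apply: (max_run_start (valP r)); rewrite ra.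
have stop (r : run_type) : run_boundary u ((val r).1 + run_length (val r)).
  rewrite (max_run_length (valP r)).
  have [lt_n|ge_n] := ltnP (val r).2.+1 n; last first.
    by left; apply/eqP; rewrite eqn_leq ge_n ltn_ord.
  right; exists (Ordinal lt_n); rewrite -antifixed_flip; split; last by left.
  exact: (max_run_end (valP r)).
have le_n (r : run_type) : (val r).1 + run_length (val r) <= n.
  by rewrite (max_run_length (valP r)) ltn_ord.
split=> [[uc ua walk]|/andP[/forallP runs /set1P free]].
  apply/andP; split; last first.
    apply/set1P/setP => -[[i s] /= i_free]; rewrite !inE /=.
    have ui : u i != i by rewrite -antifixed_flip.
    by case: s i_free => /= i_free; [rewrite -(uc i ui) | rewrite -(ua i ui)].
  apply/forallP => r; rewrite runs_eq; apply/run_slice_reduced_catalan.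
  have eqa : fixed_count u (val r).1 = W (val r).1.
    by apply: start => p le_pn bp _; case: (walk p le_pn) => _ ->.
  split=> [k le_k|]; rewrite -eqa -(max_run_count (valP r)) //.
    have le_kn : (val r).1 + k <= n by rewrite (leq_trans _ (le_n r)) // leq_add2l.
    by case: (walk _ le_kn).
  by case: (walk _ (le_n r)) => _ ->.
have freeE (y : 'I_n * bool) : ~~ antifixed v y.1 ->
    (column y \in I) = if y.2 then u y.1 < y.1 else (u^-1)%g y.1 < y.1.
  by move=> y_free; have /setP/(_ (Sub y y_free)) := free; rewrite !inE.
split=> [i|i|].
- by rewrite -antifixed_flip => /(freeE (i, true)).
- by rewrite -antifixed_flip => /(freeE (i, false)).
elim/ltn_ind=> -[|q] IHp lt_qn.
  by rewrite /fixed_count /fixed_weight !prefix_count0.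
pose i := Ordinal lt_qn; have [fix_i|free_i] := boolP (antifixed v i); last first.
  have [_ eq_q] := IHp q (ltnSn q) (ltnW lt_qn).
  suff : fixed_count u q.+1 = W q.+1 by rewrite -/W => ->.
  have nfix A : prefix_count (predI (fun i => u i == i) A) q.+1
      = prefix_count (predI (fun i => u i == i) A) q.
    have /= -> := prefix_countS (predI (fun i => u i == i) A) i.
    by rewrite -antifixed_flip (negPf free_i) addn0.
  rewrite /W /fixed_weight !nfix -/(fixed_weight _ _ _ _) -eq_q; last first.
    by right; exists i; rewrite -antifixed_flip; split=> //; left.
  rewrite /fixed_count; have /= -> := prefix_countS (fun i => u i == i) i.
  by rewrite -antifixed_flip (negPf free_i) addn0.
have [r0 r0_max /= ri] := max_run_exists fix_i; pose r : run_type := Sub r0 r0_max.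
have := runs r; rewrite runs_eq => /run_slice_reduced_catalan[le_W eq_W].
have eqa : fixed_count u (val r).1 = W (val r).1.
  apply: start => p le_pn bp le_pr; case: (IHp p _ le_pn) => [|_ ->//].
  by rewrite ltnS (leq_trans le_pr) //; case/andP: ri.
have [k qE le_k] : exists2 k, q.+1 = (val r).1 + k & k <= run_length (val r).
  by exists (q.+1 - r0.1); rewrite /= ?/run_length; lia.
rewrite qE -/W max_run_count ?(valP r) // eqa; split; first exact: le_W.
(* Strictly inside the run the indices on both sides of [q + 1] are fixed, so a boundary can only be
   the end of the run. *)
move=> boundary; suff -> : k = run_length (val r) by rewrite eq_W.
suff le_r : r0.2 <= q.
  apply/eqP; rewrite -(eqn_add2l r0.1) (max_run_length r0_max) -qE eqSS.
  by rewrite eqn_leq le_r; case/andP: ri => _ ->.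
rewrite -qE in boundary; case: boundary => [qn|[j [uj jE]]].
  by rewrite -ltnS qn.
rewrite leqNgt; apply: contra uj => lt_q; rewrite -antifixed_flip.
apply: (max_run_antifixed r0_max); case/andP: ri => le1 le2.
by case: jE => [->|[->]]; rewrite ?lt_q ?le1 ?le2 // andbT ltnW.
Qed.

End Runs.

(** * The partition into blocks *)

Section Blocks.
Variable n : nat.
Implicit Types (v w : 'S_n) (I : {set 'I_(2 * n)}).

(** Defined as a preimage of the direct sum, so that the matroid, the isomorphism and the
    cardinality are transported along [column_of]; [mem_block] gives the other description. *)
Definition block v : {set {set 'I_(2 * n)}} :=
  [set I : {set 'I_(2 * n)} |
    @column_of n v @^-1: I \in direct_sum2 (run_catalan_sum v) [set free_basis v]].

Lemma mem_block v I :
  I \in block v <-> compatible (flip v) (half_set I true) (half_set I false).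
Proof. by rewrite inE; split=> /compatible_direct_sum. Qed.

Lemma block_rank v I p q : avoids123 v -> I \in block v -> p <= n -> q <= n ->
  perm_rank (flip v) p q
  = minn (minn p q) (prefix_count (half_set I true) p + prefix_count (half_set I false) q).
Proof. by move=> /avoids123_flip v321 /mem_block; apply: compatible_rank. Qed.

Lemma flip_inj : injective (@flip n).
Proof. by move=> v w /mulIg. Qed.

(** [I] determines the rank function of the reversed permutation, hence the permutation. *)
Lemma block_disjoint v w I :
  avoids123 v -> avoids123 w -> I \in block v -> I \in block w -> v = w.
Proof.
move=> v123 w123 Iv Iw; apply: flip_inj; apply: perm_rank_inj => p q le_pn le_qn.
by rewrite (block_rank v123 Iv) // (block_rank w123 Iw).
Qed.

Lemma card_block v I : I \in block v -> #|I| = n.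
Proof. by move/mem_block/compatible_card; rewrite card_halves. Qed.

Lemma block_exists I : #|I| = n -> exists2 v, avoids123 v & I \in block v.
Proof.
rewrite card_halves => /compatible_exists[u [u321 comp]].
have [v uE] := flip_surj u; exists v; first by apply/avoids123_flip; rewrite -uE.
by apply/mem_block; rewrite -uE.
Qed.

Lemma block_P (F : fieldType) v w I : avoids123 v -> I \in block v ->
  (I \in P F w) = bruhat_le w v.
Proof.
move=> v123 Iv; apply/idP/idP => [/mem_P_transversal[_ [f fP]]|le_wv].
  apply: perm_rank_le_bruhat => p q le_pn le_qn.
  by rewrite (block_rank v123 Iv) // (transversal_rank fP).
apply/mem_P_transversal; split; first exact: card_block Iv.
exact/(transversal_bruhat le_wv)/compatible_transversal/mem_block.
Qed.

Lemma blocks_disjoint (D : {set 'S_n}) : {in D, forall v, avoids123 v} ->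
  {in D &, forall v w, v != w -> [disjoint block v & block w]}.
Proof.
move=> D123 v w Dv Dw; apply: contraR => /pred0Pn[I /andP[Iv Iw]].
by apply/eqP; apply: block_disjoint Iv Iw; apply: D123.
Qed.

Lemma block_sum v : avoids123 v ->
  [/\ is_matroid (block v),
      matroid_iso (block v) (direct_sum2 (run_catalan_sum v) [set free_basis v])
    & #|block v| = g v].
Proof.
have bl (I : {set 'I_(2 * n)}) : (I \in block v) = (@column_of n v @^-1: I \in
    direct_sum2 (run_catalan_sum v) [set free_basis v]) by rewrite inE.
have bij := @column_of_bij n v; split.
- apply: preimage_matroid bij bl _; apply: direct_sum2_matroid (singleton_matroid _).
  by apply: direct_sum_matroid => r; apply: reduced_catalan_is_matroid.
- exact: preimage_matroid_iso bij bl.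
rewrite (card_preimage_matroid bij bl) card_direct_sum2 cards1 muln1 card_direct_sum.
rewrite /g (reindex_omap (val : run_type v -> _) insub) => [|r r_max]; last by rewrite insubT.
by apply: eq_big => [r|r _]; [rewrite (valP r) valK eqxx | apply: card_reduced_catalan].
Qed.

End Blocks.

Theorem theorem1p2 (F : fieldType) (n : nat) (hn : (1 <= n)%N) :
  exists Q : 'S_n -> {set {set 'I_(2 * n)}},
    (* the Q v, for v avoiding 123, partition the n-subsets of [2n] *)
    [/\ (forall v : 'S_n, avoids123 v -> Q v != set0),
        is_disjoint_union [set v : 'S_n | avoids123 v] Q
          [set I : {set 'I_(2 * n)} | #|I| == n],
    (* (1) *)
        (forall w : 'S_n,
          is_disjoint_union [set v : 'S_n | bruhat_le w v && avoids123 v] Q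
            (P F w))
    (* (2) *)
      & forall v : 'S_n, avoids123 v ->
        [/\ is_matroid (Q v),
            (exists (T0 : finType) (N : {set {set T0}}),
              [/\ is_matroid N, #|N| = 1%N
                & matroid_iso (Q v) (direct_sum2 (run_catalan_sum v) N)])
          & #|Q v| = g v]].
Proof.
exists (@block n); split=> [v|||v].
- by case/block_sum=> [[]].
- split; first by apply: blocks_disjoint => v; rewrite inE.
  apply/setP => I; rewrite inE; apply/eqP/bigcupP => [/block_exists[v v123 Iv]|].
    by exists v => //; rewrite inE.
  by case=> v _ /card_block.
- move=> w; split; first by apply: blocks_disjoint => v; rewrite inE => /andP[].
  apply/setP => I; apply/idP/bigcupP => [IP|[v]].
    have /mem_P_transversal[cardI _] := IP; have [v v123 Iv] := block_exists cardI.
    by exists v => //; rewrite inE v123 -(block_P F w v123 Iv) IP.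
  by rewrite inE => /andP[le_wv v123] Iv; rewrite (block_P F w v123 Iv).
case/block_sum=> matQ isoQ cardQ; split=> //.
exists (free_ground v : finType), [set free_basis v]; split=> //; last exact: cards1.
exact: singleton_matroid.
Qed.
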